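(* For almost every sequence $X=(X_k)_{k\in\mathbb{N}}\in\{0,1\}^{\mathbb{N}}$ with respect to the balanced Bernoulli measure, the following holds. Put $a_X(n)=\sum_{k=0}^n X_k 2^k$ for $n\in\mathbb{N}$, and for $n\ge 1$ let $\widetilde{\mu}_{a_X(n)}$ be the probability measure on $\sqrt{\tfrac{2}{n}}\,\mathbb{Z}\subset\mathbb{R}$ defined by $$\widetilde{\mu}_{a_X(n)}(d)=\mu_{a_X(n)}\left(\sqrt{\tfrac{n}{2}}\,d\right)\qquad\text{for all } d\in\sqrt{\tfrac{2}{n}}\,\mathbb{Z}.$$ Then, as $n\to+\infty$, $\widetilde{\mu}_{a_X(n)}$ converges weakly to the standard normal law $\mathcal{N}(0,1)$, i.e. to the probability measure on $\mathbb{R}$ with density $\varphi(t)=\frac{1}{\sqrt{2\pi}}e^{-t^2/2}$.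
   Context: $\mathbb{N}=\{0,1,2,\dots\}$. For $n\in\mathbb{N}$, $s_2(n)$ is the number of digits $1$ in the binary expansion of $n$. For $a\in\mathbb{N}$, $\mu_a$ is the probability measure on $\mathbb{Z}$ given by $$\mu_a(d)=\lim_{N\to+\infty}\frac1N\#\{n<N : s_2(n+a)-s_2(n)=d\},\qquad d\in\mathbb{Z}$$ (it is known that these limits exist and define a probability measure). The balanced Bernoulli measure on $\{0,1\}^{\mathbb{N}}$ is the product measure under which the coordinates $X_k$ are independent and take the values $0$ and $1$ with probability $\frac12$ each. Weak convergence means convergence of integrals against every bounded continuous function on $\mathbb{R}$. *)

(* Defs.v *)
From HB Require Import structures.
From mathcomp Require Export all_boot all_order all_algebra.
From mathcomp Require Export all_classical all_reals all_analysis.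
Export Order.TTheory GRing.Theory Num.Theory.
Export numFieldNormedType.Exports.

Set Implicit Arguments.
Unset Strict Implicit.
Unset Printing Implicit Defensive.

Local Open Scope classical_set_scope.
Local Open Scope ring_scope.

(* The [i]-th binary digit of [n] is [odd (n %/ 2 ^ i)]; since [n < 2 ^ n],
   the digits of index [i >= n] all vanish. *)
Definition s2 (n : nat) : nat := (\sum_(i < n) odd (n %/ 2 ^ i))%N.

Definition mu_freq (R : realType) (a : nat) (d : int) (N : nat) : R :=
  #|[set n : 'I_N | (s2 (n + a))%:Z - (s2 n)%:Z == d]|%:R / N%:R.

Definition mu_mass (R : realType) (a : nat) (d : int) : R :=
  limn (mu_freq R a d).

Lemma mu_mass_ge0 (R : realType) (a : nat) (d : int) : 0 <= mu_mass R a d.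
Proof.
rewrite /mu_mass; have [cv|dv] := pselect (cvgn (mu_freq R a d)).
  by apply: limr_ge => //; near=> N; rewrite divr_ge0.
by rewrite dvgP.
Unshelve. all: by end_near. Qed.

HB.instance Definition _ := isPointed.Build int 0.
HB.instance Definition _ := @isMeasurable.Build default_measure_display
  int discrete_measurable discrete_measurable0
  discrete_measurableC discrete_measurableU.

Definition mu_ (R : realType) (a : nat) (A : set int) : \bar R :=
  \esum_(d in A) (mu_mass R a d)%:E.

Section mu_measure.
Local Open Scope ereal_scope.
Variables (R : realType) (a : nat).

Let mu0 : mu_ R a set0 = 0.
Proof. by rewrite /mu_ esum_set0. Qed.

Let mu_ge0 (A : set int) : 0 <= mu_ R a A.
Proof. by apply: esum_ge0 => d _; rewrite lee_fin mu_mass_ge0. Qed.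

Let mu_sigma_additive : semi_sigma_additive (mu_ R a).
Proof.
move=> F _ tF _; rewrite /mu_ nneseries_sum_bigcup//; last first.
  by move=> d; rewrite lee_fin mu_mass_ge0.
by apply: is_cvg_ereal_nneg_natsum_cond => n _ _; exact: mu_ge0.
Qed.

HB.instance Definition _ := isMeasure.Build _ _ _ (mu_ R a)
  mu0 mu_ge0 mu_sigma_additive.

End mu_measure.

Lemma mu_set1 (R : realType) (a : nat) (d : int) :
  mu_ R a [set d] = (mu_mass R a d)%:E.
Proof. by rewrite /mu_ esum_set1// lee_fin mu_mass_ge0. Qed.

(* The measurable space {0,1}^N, with the product sigma-algebra. *)
Definition cylinders : set (set (nat -> bool)) :=
  [set A | exists k b, A = [set X | X k = b]].

Definition bitseq_space := g_sigma_algebraType cylinders.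

(* [P] is the product of countably many copies of the Bernoulli measure of
   parameter 1/2. *)
Definition balanced_bernoulli (R : realType) (P : probability bitseq_space R) :=
  forall (n : nat) (B : nat -> set bool),
    P [set X : nat -> bool | forall k, (k < n)%N -> B k (X k)] =
    (\prod_(k < n) bernoulli_prob (2^-1 : R) (B k))%E.

Definition aX (X : nat -> bool) (n : nat) : nat :=
  (\sum_(k < n.+1) X k * 2 ^ k)%N.

Definition rescale (R : realType) (n : nat) (k : int) : measurableTypeR R :=
  Num.sqrt (2 / n%:R) * k%:~R.

(* The law rescaled by sqrt(2/n), as a Borel measure on the real line; its
   atoms are computed by [mu_tilde_set1]. *)
Definition mu_tilde (R : realType) (X : nat -> bool) (n : nat) :
    set (measurableTypeR R) -> \bar R :=
  pushforward (mu_ R (aX X n)) (rescale R n).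

Section mu_tilde_measure.
Local Open Scope ereal_scope.
Variables (R : realType) (X : nat -> bool) (n : nat).

Let mu_tilde0 : mu_tilde X n set0 = 0 :> \bar R.
Proof. by rewrite /mu_tilde /pushforward preimage_set0 measure0. Qed.

Let mu_tilde_ge0 (A : set (measurableTypeR R)) : 0 <= mu_tilde X n A.
Proof. exact: measure_ge0. Qed.

Let mu_tilde_sigma_additive : semi_sigma_additive (@mu_tilde R X n).
Proof.
have mr : measurable_fun [set: int] (rescale R n) by [].
exact: (@measure_semi_sigma_additive _ _ _
  (pushforward (mu_ R (aX X n)) (rescale R n) : {measure set _ -> \bar R})).
Qed.

HB.instance Definition _ := isMeasure.Build _ _ _ (@mu_tilde R X n)
  mu_tilde0 mu_tilde_ge0 mu_tilde_sigma_additive.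

End mu_tilde_measure.

Lemma mu_tilde_set1 (R : realType) (X : nat -> bool) (n : nat) (k : int) :
  (0 < n)%N ->
  mu_tilde X n [set Num.sqrt (2 / n%:R) * k%:~R] = mu_ R (aX X n) [set k].
Proof.
move=> n0; rewrite /mu_tilde /pushforward; congr (mu_ _ _ _).
have s0 : Num.sqrt (2 / n%:R) != 0 :> R.
  by rewrite sqrtr_eq0 -ltNge divr_gt0// ltr0n.
apply/seteqP; split=> j /=; last by move=> ->.
by move=> /(mulfI s0)/intr_inj.
Qed.

Definition weak_cvg (R : realType)
    (m : nat -> {measure set (measurableTypeR R) -> \bar R})
    (l : {measure set (measurableTypeR R) -> \bar R}) :=
  forall f : R -> R, continuous f -> (exists M, forall x, `|f x| <= M) ->
    (\int[m n]_x (f x)%:E)%E @[n --> \oo] --> (\int[l]_x (f x)%:E)%E.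

(* Main.v *)
(* Feeding the digits of a from the lowest one into the addition n + a, with n
   uniformly random, the variation D = s_2(n + a) - s_2(n) is a sum of eps_k T_k,
   where T_k = 1 when the k-th digit of a differs from the current carry and
   T_k = 0 otherwise, and the signs eps_k are fair and independent: a step with
   T_k = 1 adds +1 and produces the carry 0, or adds -1 and produces the carry 1.
   Hence, with Q the number of active steps, exp(i theta D) / cos(theta)^Q is an
   exact martingale.  When the digits of a are themselves fair and independent,
   so are the T_k, so that Q - n/2 has fourth moment O(n^2); by Fubini and
   summability, for almost every X the conditional fourth moment of
   (2Q - n)/n tends to 0.  For such X the martingale identity with
   theta = t sqrt(2/n) gives convergence of the characteristic functions to
   exp(-t^2/2), which is extended to bounded continuous functions by uniform
   trigonometric approximation on compact sets and a second moment bound. *)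
Require Import Defs.
From mathcomp Require Import measurable_realfun normal_distribution.
From mathcomp Require Import zify ring lra.

Set Implicit Arguments.
Unset Strict Implicit.
Unset Printing Implicit Defensive.

Local Open Scope classical_set_scope.
Local Open Scope ring_scope.

(** * The laws [mu_a] *)

Lemma s2_widen (n k : nat) : (n <= k)%N ->
  s2 n = (\sum_(i < k) odd (n %/ 2 ^ i))%N.
Proof.
move=> nk; rewrite /s2 -!(big_mkord xpredT (fun i => nat_of_bool (odd (n %/ 2 ^ i)))).
have -> : (\sum_(0 <= i < k) odd (n %/ 2 ^ i) =
  \sum_(0 <= i < n) odd (n %/ 2 ^ i) + \sum_(n <= i < k) odd (n %/ 2 ^ i))%N.
  by rewrite -big_cat_nat.
rewrite [X in (_ + X)%N]big_nat_cond [X in (_ + X)%N]big1 ?addn0// => i.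
move=> /andP[/andP[ni _] _]; rewrite divn_small//.
by rewrite (leq_ltn_trans ni)// ltn_expl.
Qed.

Lemma s2_bit (b : bool) (n : nat) : s2 (b + n.*2) = (b + s2 n)%N.
Proof.
have E : (b + n.*2 <= (b + n.*2).+1)%N by [].
rewrite (s2_widen E) big_ord_recl /= expn0 divn1 oddD odd_double addbF oddb.
congr addn; rewrite (@s2_widen n (b + n.*2)); last by case: b {E}; lia.
apply: eq_bigr => i _; rewrite /bump /= add1n expnS divnMA.
by rewrite divn2 halfD odd_double andbF add0n doubleK; case: b {E} i.
Qed.

Definition s2_diff (a n : nat) : int := (s2 (n + a))%:Z - (s2 n)%:Z.

Lemma s2_diff_double (b : bool) (a n : nat) :
  s2_diff a.*2 (b + n.*2) = s2_diff a n.
Proof.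
rewrite /s2_diff -addnA -doubleD !s2_bit !PoszD; ring.
Qed.

(** Lowest digits 0 and 1 give a new digit 1 and no carry. *)
Lemma s2_diff_doubleS0 (a n : nat) : s2_diff a.*2.+1 n.*2 = s2_diff a n + 1.
Proof.
rewrite /s2_diff.
have -> : (n.*2 + a.*2.+1 = true + (n + a).*2)%N by rewrite doubleD; lia.
have -> : s2 n.*2 = s2 n by rewrite -[n.*2]/(false + n.*2)%N s2_bit.
by rewrite s2_bit/=; lia.
Qed.

(** Two lowest digits 1 leave 0 and a carry, which the remaining digits see as [a.+1] in place of
    [a]. *)
Lemma s2_diff_doubleS1 (a n : nat) :
  s2_diff a.*2.+1 n.*2.+1 = s2_diff a.+1 n - 1.
Proof.
rewrite /s2_diff.
have -> : (n.*2.+1 + a.*2.+1 = false + (n + a.+1).*2)%N by rewrite doubleD; lia.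
have -> : s2 n.*2.+1 = (true + s2 n)%N by rewrite -s2_bit.
by rewrite s2_bit/=; lia.
Qed.

Definition s2_count (a : nat) (d : int) (N : nat) : nat :=
  (\sum_(0 <= n < N) (s2_diff a n == d))%N.

Section freq.
Variable R : realType.

Lemma mu_freqE (a : nat) (d : int) (N : nat) :
  mu_freq R a d N = (s2_count a d N)%:R / N%:R.
Proof.
rewrite /mu_freq /s2_count; congr (_%:R / _).
rewrite -sum1_card big_mkord big_mkcond/=; apply: eq_bigr => i _.
rewrite (_ : (i \in _) = (s2_diff a i == d)); last by apply/idP/idP; rewrite !inE.
by case: eqP.
Qed.

Lemma s2_count_split (a : nat) (d : int) (N : nat) :
  s2_count a d N = (\sum_(0 <= n < uphalf N) (s2_diff a n.*2 == d) +
                    \sum_(0 <= n < N./2) (s2_diff a n.*2.+1 == d))%N.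
Proof.
rewrite /s2_count; elim: N => [|N IH]; first by rewrite !big_geq.
rewrite big_nat_recr//= IH uphalf_half.
case: (boolP (odd N)) => oN /=.
  rewrite add1n [X in (_ = _ + X)%N]big_nat_recr//= addnA.
  by rewrite -[in (s2_diff a N)](odd_double_half N) oN add1n.
rewrite add0n [in RHS]big_nat_recr//= addnAC.
by rewrite -[in (s2_diff a N)](odd_double_half N) (negbTE oN) add0n.
Qed.

Lemma s2_count_double (a : nat) (d : int) (N : nat) :
  s2_count a.*2 d N = (s2_count a d (uphalf N) + s2_count a d N./2)%N.
Proof.
rewrite s2_count_split; congr addn; apply: eq_bigr => n _.
  by rewrite -[n.*2]/(false + n.*2)%N s2_diff_double.
by rewrite -[n.*2.+1]/(true + n.*2)%N s2_diff_double.
Qed.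

Lemma s2_count_doubleS (a : nat) (d : int) (N : nat) :
  s2_count a.*2.+1 d N =
  (s2_count a (d - 1) (uphalf N) + s2_count a.+1 (d + 1)%R N./2)%N.
Proof.
rewrite s2_count_split; congr addn; apply: eq_bigr => n _.
  by rewrite s2_diff_doubleS0; congr nat_of_bool; apply/eqP/eqP; lia.
by rewrite s2_diff_doubleS1; congr nat_of_bool; apply/eqP/eqP; lia.
Qed.

(** * Halved indices, existence of the limits and recursion for the masses *)

Lemma cvg_half_ratio : ((N./2)%:R / N%:R : R) @[N --> \oo] --> (2^-1 : R).
Proof.
apply/cvgrPdist_le => /= e e0; near=> N.
have N0 : (0 < N)%N by near: N; exact: nbhs_infty_gt.
have Ne : e^-1 <= N%:R by near: N; exact: nbhs_infty_ger.
have N0' : 0 < N%:R :> R by rewrite ltr0n.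
have -> : 2^-1 - (N./2)%:R / N%:R = (odd N)%:R / 2 / N%:R :> R.
  have NE : N%:R = (odd N)%:R + 2 * (N./2)%:R :> R.
    by rewrite -[in LHS](odd_double_half N) natrD -muln2 natrM mulrC.
  have := N0'; rewrite NE => h; field; lra.
rewrite ger0_norm ?divr_ge0// ler_pdivrMr//.
have : 1 <= e * N%:R by rewrite -ler_pdivrMl// mulr1.
by case: odd => /=; lra.
Unshelve. all: by end_near. Qed.

Lemma cvg_uphalf_ratio : ((uphalf N)%:R / N%:R : R) @[N --> \oo] --> (2^-1 : R).
Proof.
have : (1 - (N./2)%:R / N%:R : R) @[N --> \oo] --> (1 - 2^-1 : R).
  by apply: cvgB; [exact: cvg_cst|exact: cvg_half_ratio].
have -> : 1 - 2^-1 = 2^-1 :> R by field.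
apply: cvg_trans; apply: near_eq_cvg; near=> N.
have N0 : (0 < N)%N by near: N; exact: nbhs_infty_gt.
have N0' : N%:R != 0 :> R by rewrite pnatr_eq0 -lt0n.
apply: (mulIf N0'); rewrite mulrBl !divfK// mul1r.
rewrite -{1}(odd_double_half N) uphalf_half -muln2 !natrD natrM; ring.
Unshelve. all: by end_near. Qed.

Lemma cvg_uphalf : uphalf N @[N --> \oo] --> \oo.
Proof.
apply/cvgnyPge => A; near=> N.
have : (A.*2 <= N)%N by near: N; exact: nbhs_infty_ge.
by rewrite geq_uphalf_double; lia.
Unshelve. all: by end_near. Qed.

Lemma cvg_half : N./2 @[N --> \oo] --> \oo.
Proof.
apply/cvgnyPge => A; near=> N.
have : (A.*2 <= N)%N by near: N; exact: nbhs_infty_ge.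
by rewrite geq_half_double; lia.
Unshelve. all: by end_near. Qed.

(** The ratio factors as [c (h N) / h N] times [h N / N]. It is applied with [h N] the number of
    even, or of odd, integers below [N]. *)
Lemma cvg_count_subsample (c : nat -> nat) (h : nat -> nat) (l r : R) :
  (h N @[N --> \oo] --> \oo) -> ((h N)%:R / N%:R @[N --> \oo] --> r) ->
  ((c N)%:R / N%:R @[N --> \oo] --> l) ->
  (c (h N))%:R / N%:R @[N --> \oo] --> l * r.
Proof.
move=> hy hr cl.
have chl : (c (h N))%:R / (h N)%:R @[N --> \oo] --> l by exact: cvg_comp hy cl.
apply: cvg_trans (cvgM chl hr); apply: near_eq_cvg; near=> N.
have hN0 : (h N)%:R != 0 :> R.
  rewrite pnatr_eq0 -lt0n; near: N.
  by move/cvgnyPgt : hy => /(_ 0%N).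
by rewrite /= mulrA divfK.
Unshelve. all: by end_near. Qed.

Lemma mu_freq_double (a : nat) (d : int) (l : R) :
  (mu_freq R a d @ \oo --> l) -> (mu_freq R a.*2 d @ \oo --> l).
Proof.
move=> cl.
have c : ((s2_count a d N)%:R / N%:R : R) @[N --> \oo] --> l.
  by rewrite -(funext (mu_freqE a d)).
have -> : l = l * 2^-1 + l * 2^-1 by field.
apply: cvg_trans (cvgD (cvg_count_subsample cvg_uphalf cvg_uphalf_ratio c)
  (cvg_count_subsample cvg_half cvg_half_ratio c)).
apply: near_eq_cvg; near=> N; rewrite fctE.
by rewrite mu_freqE s2_count_double natrD mulrDl.
Unshelve. all: by end_near. Qed.

Lemma mu_freq_doubleS (a : nat) (d : int) (l r : R) :
  (mu_freq R a (d - 1) @ \oo --> l) -> (mu_freq R a.+1 (d + 1) @ \oo --> r) ->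
  (mu_freq R a.*2.+1 d @ \oo --> (l + r) / 2).
Proof.
move=> cl cr.
have c : ((s2_count a (d - 1) N)%:R / N%:R : R) @[N --> \oo] --> l.
  by rewrite -(funext (mu_freqE a (d - 1))).
have c' : ((s2_count a.+1 (d + 1)%R N)%:R / N%:R : R) @[N --> \oo] --> r.
  by rewrite -(funext (mu_freqE a.+1 (d + 1))).
rewrite mulrDl.
apply: cvg_trans (cvgD (cvg_count_subsample cvg_uphalf cvg_uphalf_ratio c)
  (cvg_count_subsample cvg_half cvg_half_ratio c')).
apply: near_eq_cvg; near=> N; rewrite fctE.
by rewrite mu_freqE s2_count_doubleS natrD mulrDl.
Unshelve. all: by end_near. Qed.

Lemma mu_freq0 (d : int) : mu_freq R 0 d @ \oo --> ((d == 0)%:R : R).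
Proof.
apply: cvg_near_cst; near=> N.
have N0 : (0 < N)%N by near: N; exact: nbhs_infty_gt.
rewrite mu_freqE /s2_count.
under eq_bigr do rewrite /s2_diff addn0 subrr.
rewrite sum_nat_const_nat subn0 natrM eq_sym mulrAC divff ?mul1r//.
by rewrite pnatr_eq0 -lt0n.
Unshelve. all: by end_near. Qed.

(** Adding 1 clears the trailing ones and creates a single new one. Hence for [a = 1] the
    frequencies vanish when [d >= 2]. *)
Lemma s2_diff1_le1 (n : nat) : s2_diff 1 n <= 1.
Proof.
elim/ltn_ind: n => n IH; rewrite -(odd_double_half n).
case: (boolP (odd n)) => on.
  rewrite add1n -[1%N]/(0.*2.+1) s2_diff_doubleS1.
  have /IH h : (n./2 < n)%N by case: n on {IH} => // n _; lia.
  by rewrite -[1%N]/1%N; lia.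
by rewrite add0n -[1%N]/(0.*2.+1) s2_diff_doubleS0 /s2_diff addn0 subrr.
Qed.

(** Since [1 = 0.*2.+1], the odd case of the recursion refers back to [a = 1], but at [d + 1]. The
    induction therefore descends in [d], starting from [d >= 2] where the frequencies are 0. *)
Lemma mu_freq1_cvg (d : int) : cvgn (mu_freq R 1 d).
Proof.
have [k dk] : exists k : nat, (2 - k%:Z <= d)%R by exists `|2 - d|%N; lia.
elim: k d dk => [|k IH] d dk.
  apply/cvg_ex; exists 0; apply: cvg_near_cst; near=> N.
  rewrite mu_freqE /s2_count big1 ?mul0r// => n _.
  by have := s2_diff1_le1 n; case: eqP => // ->; lia.
have c0 := @mu_freq0 (d - 1).
have /cvg_ex[l cl] : cvgn (mu_freq R 1 (d + 1)) by apply: IH; lia.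
by apply/cvg_ex; eexists; apply: (mu_freq_doubleS c0 cl).
Unshelve. all: by end_near. Qed.

(** Strong induction on [a]: for [a = 2b + 1 >= 3] both [b] and [b + 1] are smaller than [a]. The
    values 0 and 1 are treated apart. *)
Lemma mu_freq_cvg (a : nat) (d : int) : cvgn (mu_freq R a d).
Proof.
elim/ltn_ind: a d => -[|[|a]] IH d.
- by apply/cvg_ex; eexists; exact: mu_freq0.
- exact: mu_freq1_cvg.
- have E := odd_double_half a.+2.
  have [b bE] : exists b, b = a.+2./2 by eexists.
  rewrite -bE in E; case: (odd a.+2) E => E.
    have /cvg_ex[l cl] : cvgn (mu_freq R b (d - 1)) by apply: IH; lia.
    have /cvg_ex[r cr] : cvgn (mu_freq R b.+1 (d + 1)) by apply: IH; lia.
    by rewrite -E; apply/cvg_ex; eexists; exact: mu_freq_doubleS cl cr.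
  have /cvg_ex[l cl] : cvgn (mu_freq R b d) by apply: IH; lia.
  by rewrite -E; apply/cvg_ex; eexists; exact: mu_freq_double cl.
Qed.

Lemma mu_mass_cvg (a : nat) (d : int) : mu_freq R a d @ \oo --> mu_mass R a d.
Proof. exact: mu_freq_cvg. Qed.

Lemma mu_mass0 (d : int) : mu_mass R 0 d = (d == 0)%:R.
Proof. by apply/cvg_lim => //; exact: mu_freq0. Qed.

Lemma mu_mass_double (a : nat) (d : int) : mu_mass R a.*2 d = mu_mass R a d.
Proof. by apply/cvg_lim => //; apply: mu_freq_double; exact: mu_mass_cvg. Qed.

Lemma mu_mass_doubleS (a : nat) (d : int) :
  mu_mass R a.*2.+1 d = (mu_mass R a (d - 1) + mu_mass R a.+1 (d + 1)) / 2.
Proof. by apply/cvg_lim => //; apply: mu_freq_doubleS; exact: mu_mass_cvg. Qed.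

Lemma cvg_sum_seq (I : Type) (s : seq I) (u : I -> nat -> R) (l : I -> R) :
  (forall i, u i @ \oo --> l i) ->
  \sum_(i <- s) u i n @[n --> \oo] --> \sum_(i <- s) l i.
Proof.
move=> ul; elim: s => [|i s IH].
  by under eq_fun do rewrite big_nil; rewrite big_nil; exact: cvg_cst.
under eq_fun do rewrite big_cons.
by rewrite big_cons; apply: cvgD => //; exact: ul.
Qed.

(** Each [n] is counted for at most one [d] of the list, so finite sums of frequencies are at most
    1. Equality of the total mass with 1 comes later, from the walk. *)
Lemma sum_mu_mass_le1 (a : nat) (s : seq int) : uniq s ->
  \sum_(d <- s) mu_mass R a d <= 1.
Proof.
move=> us.
have c : (\sum_(d <- s) mu_freq R a d N) @[N --> \oo] -->
    \sum_(d <- s) mu_mass R a d.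
  by apply: cvg_sum_seq => d; exact: mu_mass_cvg.
rewrite -(cvg_lim _ c)//; apply: limr_le; first by apply/cvg_ex; eexists; exact: c.
near=> N.
have N0 : (0 < N)%N by near: N; exact: nbhs_infty_gt.
under eq_bigr do rewrite mu_freqE.
rewrite -mulr_suml ler_pdivrMr ?ltr0n// mul1r -natr_sum ler_nat /s2_count.
rewrite exchange_big/= -[leqRHS]subn0 -[leqRHS]muln1 -sum_nat_const_nat.
apply: leq_sum => n _.
have := count_uniq_mem (s2_diff a n) us.
rewrite -sum1_count big_mkcond/= => E; under eq_bigr do rewrite eq_sym.
have -> : (\sum_(i <- s) (i == s2_diff a n) =
    \sum_(i <- s) if i == s2_diff a n then 1 else 0)%N.
  by apply: eq_bigr => i _; case: eqP.
by rewrite E; case: (_ \in _).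
Unshelve. all: by end_near. Qed.

End freq.

(** * The carry walk *)

Section carry_walk.
Variable R : realType.
Implicit Types (F G : bool -> int -> nat -> R) (xs ys : seq bool).

(* Mean of [F] over the fair signs drawn while adding the digits [xs], lowest
   first, from carry [c], current variation [d] and [q] signs already drawn. *)
Fixpoint walk xs F (c : bool) (d : int) (q : nat) : R :=
  if xs is x :: xs' then
    if x == c then walk xs' F c d q
    else (walk xs' F false (d + 1) q.+1 + walk xs' F true (d - 1) q.+1) / 2
  else F c d q.

Lemma walk_cat xs ys F c d q :
  walk (xs ++ ys) F c d q = walk xs (walk ys F) c d q.
Proof.
elim: xs c d q => //= x xs IH c d q; case: ifP => _; first exact: IH.
by rewrite !IH.
Qed.

(** At most [size xs] signs are drawn, and the variation moves by at most the number drawn. This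
    lets a bound that holds on reachable states only be used with [ler_walk], which compares
    functions everywhere. *)
Lemma eq_walk_reach xs F G c d q :
  (forall c' d' q', `|d' - d| <= (q' - q)%N%:Z -> (q <= q' <= q + size xs)%N ->
    F c' d' q' = G c' d' q') ->
  walk xs F c d q = walk xs G c d q.
Proof.
elim: xs c d q => [|x xs IH] c d q FG /=.
  by apply: FG; rewrite ?subrr ?normr0 ?subnn// addn0 leqnn.
case: ifP => _; first by apply: IH => *; apply: FG => //=; lia.
by congr ((_ + _) / _); apply: IH => c' d' q' h1 h2; apply: FG => /=; lia.
Qed.

Lemma eq_walk xs F G c d q : (forall c' d' q', F c' d' q' = G c' d' q') ->
  walk xs F c d q = walk xs G c d q.
Proof. by move=> FG; apply: eq_walk_reach => *; exact: FG. Qed.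

Lemma ler_walk xs F G c d q : (forall c' d' q', F c' d' q' <= G c' d' q') ->
  walk xs F c d q <= walk xs G c d q.
Proof.
move=> FG; elim: xs c d q => [|x xs IH] c d q //=; case: ifP => _ //.
by rewrite ler_pM2r ?invr_gt0// lerD.
Qed.

Lemma walk_cst xs (k : R) c d q : walk xs (fun _ _ _ => k) c d q = k.
Proof.
elim: xs c d q => [|x xs IH] c d q //=; case: ifP => _ //.
by rewrite !IH; field.
Qed.

Lemma walkD xs F G c d q :
  walk xs (fun c d q => F c d q + G c d q) c d q = walk xs F c d q + walk xs G c d q.
Proof.
elim: xs c d q => [|x xs IH] c d q //=; case: ifP => _ //.
by rewrite !IH; field.
Qed.

Lemma walkZ xs (k : R) F c d q :
  walk xs (fun c d q => k * F c d q) c d q = k * walk xs F c d q.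
Proof.
elim: xs c d q => [|x xs IH] c d q //=; case: ifP => _ //.
by rewrite !IH; field.
Qed.

Lemma walkN xs F c d q :
  walk xs (fun c d q => - F c d q) c d q = - walk xs F c d q.
Proof.
by rewrite -mulN1r -walkZ; apply: eq_walk => *; rewrite mulN1r.
Qed.

Lemma walkB xs F G c d q :
  walk xs (fun c d q => F c d q - G c d q) c d q = walk xs F c d q - walk xs G c d q.
Proof. by rewrite walkD walkN. Qed.

Lemma walk_sum I (s : seq I) xs (F : I -> bool -> int -> nat -> R) c d q :
  walk xs (fun c d q => \sum_(i <- s) F i c d q) c d q =
  \sum_(i <- s) walk xs (F i) c d q.
Proof.
elim: s => [|i s IH].
  rewrite big_nil -[RHS](walk_cst xs 0 c d q).
  by apply: eq_walk => *; rewrite big_nil.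
rewrite big_cons -IH -walkD.
by apply: eq_walk => *; rewrite big_cons.
Qed.

Lemma ler_norm_walk xs F c d q :
  `|walk xs F c d q| <= walk xs (fun c d q => `|F c d q|) c d q.
Proof.
rewrite ler_norml -walkN; apply/andP; split; apply: ler_walk => *.
  by rewrite lerNl -normrN ler_norm.
exact: ler_norm.
Qed.

(* The walk is a simple random walk with pauses, counted out by [q], so this
   exponential functional is an exact martingale. *)
Lemma walk_cos xs (theta b : R) c d q : cos theta != 0 ->
  walk xs (fun _ d q => cos (theta * d%:~R + b) * (cos theta)^-1 ^+ q) c d q =
  cos (theta * d%:~R + b) * (cos theta)^-1 ^+ q.
Proof.
move=> k0; elim: xs c d q => [|x xs IH] c d q //=; case: ifP => _ //.
rewrite !IH exprS !rmorphD/= rmorphN/= rmorph1.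
have -> : theta * (d%:~R + 1) + b = (theta * d%:~R + b) + theta by ring.
have -> : theta * (d%:~R - 1) + b = (theta * d%:~R + b) - theta by ring.
by rewrite cosD cosB; field.
Qed.

(** A fair step adds 1 on average to the square of the variation, so subtracting the number of signs
    drawn gives a martingale. *)
Lemma walk_sqr xs c d q :
  walk xs (fun _ d q => d%:~R ^+ 2 - q%:R) c d q = d%:~R ^+ 2 - q%:R.
Proof.
elim: xs c d q => [|x xs IH] c d q //=; case: ifP => _ //.
by rewrite !IH !rmorphD/= rmorphN/= rmorph1 -natr1; field.
Qed.

Lemma walk_sqr_le xs :
  walk xs (fun _ d _ => d%:~R ^+ 2) false 0 0 <= (size xs)%:R.
Proof.
have := walk_sqr xs false 0 0.
rewrite walkB expr0n subr0 => /eqP; rewrite subr_eq0 => /eqP ->.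
rewrite -[leRHS](walk_cst xs _ false 0 0).
(* The minimum equals [q] on reachable states and is bounded by [size xs] on all states. *)
rewrite (@eq_walk_reach xs _ (fun _ _ q => Num.min q%:R (size xs)%:R)).
  by apply: ler_walk => *; rewrite ge_min lexx orbT.
by move=> c' d' q' _ /andP[_]; rewrite add0n => h; rewrite min_l// ler_nat.
Qed.

(** Along digits 0 a carry survives each step with probability 1/2 and, once lost, never
    reappears. *)
Lemma walk_nseq_carry m d q :
  walk (nseq m false) (fun c _ _ => c%:R) true d q = 2^-1 ^+ m /\
  walk (nseq m false) (fun c _ _ => c%:R) false d q = 0.
Proof.
elim: m d q => [|m IH] d q /=; first by rewrite expr0.
split; last by have [] := IH d q.
have [_ ->] := IH (d + 1) q.+1; have [-> _] := IH (d - 1) q.+1.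
by rewrite add0r exprS mulrC.
Qed.

(** Padding with zeros leaves the number unchanged and makes a final carry improbable. That carry is
    the only obstacle to reading the law [mu_a] off the end of the walk. *)
Lemma walk_carry_le xs m :
  walk (xs ++ nseq m false) (fun c _ _ => c%:R) false 0 0 <= 2^-1 ^+ m.
Proof.
rewrite walk_cat -[leRHS](walk_cst xs _ false 0 0).
apply: ler_walk => -[] d q; have [h1 h2] := walk_nseq_carry m d q.
  by rewrite h1.
by rewrite h2 exprn_ge0// invr_ge0.
Qed.

Fixpoint val2 xs : nat := if xs is x :: xs' then (x + (val2 xs').*2)%N else 0%N.

(** The mass at the remaining digits plus the carry is a martingale: a pause is the even case of the
    recursion for the masses, a fair step the odd case. Once all digits are read, only the carry
    remains. *)
Lemma walk_mu_mass xs (c : bool) (d : int) (q : nat) (e : int) :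
  mu_mass R (val2 xs + c) (e - d) =
  walk xs (fun c d _ => mu_mass R c (e - d)) c d q.
Proof.
elim: xs c d q => [|x xs IH] c d q //=.
case: eqP => [->|xc].
  have -> : (c + (val2 xs).*2 + c = (val2 xs + c).*2)%N by rewrite doubleD; lia.
  by rewrite mu_mass_double; exact: IH.
have -> : (x + (val2 xs).*2 + c = (val2 xs).*2.+1)%N by case: x c xc => -[]//= _; lia.
rewrite mu_mass_doubleS -!IH addn0 addn1 opprD addrA; congr ((_ + mu_mass _ _ _) / _).
by ring.
Qed.

(** A final carry 0 contributes exactly a point mass. A final carry 1 contributes a mass of the law
    for [a = 1], of which only nonnegativity is kept. *)
Lemma mu_mass_ge xs (e : int) :
  walk xs (fun c d _ => ((~~ c) && (d == e))%:R) false 0 0 <=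
  mu_mass R (val2 xs) e.
Proof.
have := walk_mu_mass xs false 0 0 e; rewrite addn0 subr0 => ->.
apply: ler_walk => -[] d q /=; first exact: mu_mass_ge0.
by rewrite mu_mass0 subr_eq0 eq_sym.
Qed.

(** * Averages over uniform digits and the number of active steps *)

Fixpoint words (N : nat) : seq (seq bool) :=
  if N is N'.+1 then [seq false :: s | s <- words N'] ++ [seq true :: s | s <- words N']
  else [:: [::]].

Definition average (N : nat) (G : seq bool -> R) : R :=
  (\sum_(s <- words N) G s) / 2 ^+ N.

Lemma averageS N (G : seq bool -> R) : average N.+1 G =
  (average N (fun s => G (false :: s)) + average N (fun s => G (true :: s))) / 2.
Proof.
rewrite /average /= big_cat/= !big_map exprS; field.
by rewrite expf_neq0.
Qed.

Lemma eq_average N (G G' : seq bool -> R) :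
  (forall s, G s = G' s) -> average N G = average N G'.
Proof. by move=> GG; congr (_ / _); apply: eq_bigr. Qed.

Lemma averageD N (G G' : seq bool -> R) :
  average N (fun s => G s + G' s) = average N G + average N G'.
Proof. by rewrite /average big_split/= mulrDl. Qed.

Lemma averageZr N (k : R) (G : seq bool -> R) :
  average N (fun s => G s / k) = average N G / k.
Proof. by rewrite /average -mulr_suml mulrAC. Qed.

Lemma mem_words N s : (s \in words N) = (size s == N).
Proof.
elim: N s => [|N IH] [|x s] //=.
  by rewrite mem_cat; apply/negbTE/norP; split; apply/mapP => -[].
rewrite mem_cat eqSS -IH; apply/orP/idP => [[]/mapP[t tw [_ ->]]//|sw].
by case: x; [right|left]; apply/mapP; exists s.
Qed.

Lemma uniq_words N : uniq (words N).
Proof.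
elim: N => //= N IH; rewrite cat_uniq !map_inj_uniq ?IH //=; try by move=> ? ? [].
by rewrite andbT; apply/hasPn => s /mapP[t _ ->]; apply/mapP => -[].
Qed.

Fixpoint binomial_mean (N : nat) (g : nat -> R) (q : nat) : R :=
  if N is N'.+1 then (binomial_mean N' g q + binomial_mean N' g q.+1) / 2
  else g q.

(* With uniform digits, each step moves with probability 1/2, whatever the carry. *)
Lemma average_walk N (g : nat -> R) c d q :
  average N (fun xs => walk xs (fun _ _ q => g q) c d q) = binomial_mean N g q.
Proof.
elim: N c d q => [|N IH] c d q.
  by rewrite /average /= big_seq1 expr0 divr1.
by rewrite averageS; case: c => /=; rewrite averageZr averageD !IH; field.
Qed.

(** With [B] binomial and [S = 2B - N], the second and fourth moments of [S] are [N] and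
    [3N^2 - 2N], and the odd ones vanish. The formula expands the mean of the fourth power of
    [S + (2q + N - k)]. *)
Lemma binomial_mean_pow4 N (k : R) q :
  binomial_mean N (fun q => (2 * q%:R - k) ^+ 4) q =
  (2 * q%:R + N%:R - k) ^+ 4 + 6 * N%:R * (2 * q%:R + N%:R - k) ^+ 2
  + 3 * N%:R ^+ 2 - 2 * N%:R.
Proof.
elim: N q => [|N IH] q /=; first by ring.
by rewrite !IH -!natr1; field.
Qed.

(** The conditional fourth moment, given the digits, of [(2Q - N) / N], with [Q] the number of signs
    drawn and [N] the number of digits. The fourth power gives averages of order [1 / N^2], which
    are summable; the square would only give [1 / N]. *)
Definition fluctuation xs : R :=
  walk xs (fun _ _ q => ((2 * q%:R - (size xs)%:R) / (size xs)%:R) ^+ 4) false 0 0.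

Lemma fluctuation_ge0 xs : 0 <= fluctuation xs.
Proof.
rewrite -(walk_cst xs 0 false 0 0); apply: ler_walk => _ _ q.
by rewrite exprn_even_ge0.
Qed.

Lemma average_fluctuation_le N : (0 < N)%N ->
  average N fluctuation <= 3 / N%:R ^+ 2.
Proof.
move=> N0; have N0' : 0 < N%:R :> R by rewrite ltr0n.
have -> : average N fluctuation = average N (fun xs =>
    walk xs (fun _ _ q => ((2 * q%:R - N%:R) / N%:R) ^+ 4) false 0 0).
  rewrite /average; congr (_ / _); apply: eq_big_seq => s.
  by rewrite mem_words => /eqP sN; rewrite /fluctuation sN.
have -> : average N (fun xs =>
    walk xs (fun _ _ q => ((2 * q%:R - N%:R) / N%:R) ^+ 4) false 0 0) =
    average N (fun xs => walk xs (fun _ _ q => (2 * q%:R - N%:R) ^+ 4) false 0 0)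
    / N%:R ^+ 4.
  rewrite -averageZr; apply: eq_average => xs.
  rewrite mulrC -walkZ; apply: eq_walk => _ _ q; rewrite expr_div_n mulrC//.
rewrite average_walk binomial_mean_pow4 mulr0 add0r subrr expr0n expr0n/= mulr0 !add0r.
rewrite ler_pdivrMr ?exprn_gt0//.
have -> : 3 / N%:R ^+ 2 * N%:R ^+ 4 = 3 * N%:R ^+ 2 :> R by field; lra.
by rewrite gerBl mulr_ge0.
Qed.

End carry_walk.

(** * Integrals against [mu_a] *)

Section carry_walk_law.
Variable R : realType.

Lemma mu_setT_le1 (a : nat) : (mu_ R a [set: int] <= 1%:E)%E.
Proof.
apply: ge_ereal_sup => _ [A [fA _] <-].
rewrite fsbig_finite//= sumEFin lee_fin.
by apply: sum_mu_mass_le1; exact: finmap.fset_uniq.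
Qed.

Lemma mu_integrable_bounded (a : nat) (g : int -> R) (M : R) :
  (forall d, `|g d| <= M) -> (mu_ R a).-integrable [set: int] (EFin \o g).
Proof.
move=> gM; apply/integrableP; split => //.
apply: (@le_lt_trans _ _ (\int[mu_ R a]_d M%:E)%E).
  by apply: ge0_le_integral => //= d _; rewrite lee_fin// ?gM// (le_trans _ (gM d)).
rewrite integral_cst//= (@le_lt_trans _ _ (M%:E * 1)%E)//; last by rewrite mule1 ltry.
apply: lee_wpmul2l; first by rewrite lee_fin (le_trans _ (gM 0)).
exact: mu_setT_le1.
Qed.

(** On the reachable range [g] is a finite combination of indicators of points, to each of which
    [mu_mass_ge] applies. Nonnegativity of [g] allows the rest of the integral to be dropped. *)
Lemma mu_integral_ge (xs : seq bool) (g : int -> R) (M : R) :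
  (forall d, 0 <= g d <= M) ->
  walk xs (fun c d _ => (~~ c)%:R * g d) false 0 0 <=
  \int[mu_ R (val2 xs)]_(d in [set: int]) g d.
Proof.
move=> gM.
have g0 d : 0 <= g d by case/andP: (gM d).
have gM' d : `|g d| <= M by rewrite ger0_norm//; case/andP: (gM d).
pose N := size xs.
(* All integers from [-N] to [N], which contain every variation reachable with [N] digits. *)
pose r : seq int := [seq (i%:Z - N%:Z) | i <- iota 0 (2 * N).+1].
have ur : uniq r by rewrite map_inj_uniq ?iota_uniq// => i j; lia.
have rN (d : int) : (`|d| <= N%:Z)%R -> d \in r.
  move=> dN; apply/mapP; exists (absz (d + N%:Z)); last by lia.
  by rewrite mem_iota; lia.
rewrite (@eq_walk_reach _ _ _ (fun c d _ =>
    \sum_(e <- r) g e * ((~~ c) && (d == e))%:R)); last first.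
  move=> c d q dq /andP[_ qN].
  have dr : d \in r by apply: rN; rewrite /N; lia.
  rewrite (bigD1_seq d)//= eqxx andbT big1 ?addr0 1?mulrC// => e ed.
  by rewrite eq_sym (negbTE ed) andbF mulr0.
rewrite walk_sum.
have gr d : \sum_(e <- r) g e * \1_[set e] d <= g d.
  have [dr|dr] := boolP (d \in r).
    rewrite (bigD1_seq d)//= big1 ?addr0 => [|e ed].
      by rewrite indicE mem_set// mulr1.
    by rewrite indicE memNset ?mulr0//= => de; rewrite de eqxx in ed.
  rewrite big1_seq// => e /andP[_ er].
  by rewrite indicE memNset ?mulr0//= => de; rewrite de er in dr.
have I (h : int -> R) : (forall d, `|h d| <= M) ->
    (mu_ R (val2 xs)).-integrable [set: int] (EFin \o h).
  by move=> hM; apply: mu_integrable_bounded hM.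
have sum0 d : 0 <= \sum_(e <- r) g e * \1_[set e] d.
  by apply: sumr_ge0 => e _; rewrite mulr_ge0.
have -> : \sum_(e <- r) walk xs (fun c d _ => g e * ((~~ c) && (d == e))%:R) false 0 0 =
   \sum_(e <- r) g e * walk xs (fun c d _ => ((~~ c) && (d == e))%:R) false 0 0 :> R.
  by apply: eq_bigr => e _; rewrite walkZ.
apply: (@le_trans _ _ (\sum_(e <- r) g e * mu_mass R (val2 xs) e)).
  by apply: ler_sum => e _; rewrite ler_wpM2l// mu_mass_ge.
rewrite -lee_fin fineK; last by apply: integrable_fin_num => //; exact: I gM'.
rewrite -sumEFin.
rewrite (@le_trans _ _ (\int[mu_ R (val2 xs)]_d \sum_(e <- r) (g e * \1_[set e] d)%:E)%E)//.
  rewrite ge0_integral_sum//; last by move=> e d _; rewrite lee_fin mulr_ge0.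
  apply: lee_sum => e _.
  under eq_integral do rewrite EFinM.
  rewrite ge0_integralZl ?lee_fin//.
  by rewrite integral_indic// setIT EFinM -mu_set1.
apply: ge0_le_integral => //.
- by move=> d _; rewrite sumEFin lee_fin.
- by move=> d _; rewrite sumEFin lee_fin.
Qed.

Lemma mu_setT_ge (xs : seq bool) (m : nat) :
  ((1 - 2^-1 ^+ m)%:E <= mu_ R (val2 (xs ++ nseq m false)) [set: int])%E.
Proof.
have h1 d : 0 <= (fun _ : int => 1 : R) d <= 1 by rewrite ler01 lexx.
have := mu_integral_ge (xs ++ nseq m false) h1.
rewrite -lee_fin fineK; last first.
  apply: integrable_fin_num => //; apply: (@mu_integrable_bounded _ _ 1) => d.
  by rewrite normr1.
rewrite integral_cst// mul1e; apply: le_trans; rewrite lee_fin.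
rewrite (@eq_walk _ _ _ (fun c _ _ => 1 - c%:R)); last first.
  by move=> [] d q /=; rewrite mulr1 ?subrr ?subr0.
by rewrite walkB walk_cst lerB// walk_carry_le.
Qed.

(** No mass escapes to infinity: the padded lower bound [1 - 2^-m] concerns the same number for
    every [m]. *)
Lemma mu_setT (xs : seq bool) : mu_ R (val2 xs) [set: int] = 1%:E.
Proof.
apply/eqP; rewrite eq_le mu_setT_le1/=; apply/lee_addgt0Pr => e e0.
have : (2^-1 ^+ m : R) @[m --> \oo] --> (0 : R).
  by apply: cvg_expr; rewrite ger0_norm ?invr_ge0// invf_lt1 ?ltr1n.
move=> /cvgr0_norm_lt /(_ _ e0) [m _ /(_ m (leqnn _)) me].
have := mu_setT_ge xs m.
have -> : val2 (xs ++ nseq m false) = val2 xs.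
  by elim: xs => [|x xs /= ->//]; elim: m {me} => //= m ->.
move=> h; rewrite -leeBlDr//; apply: le_trans h; rewrite -EFinB lee_fin lerB//.
by rewrite ltW// (le_lt_trans (ler_norm _)).
Qed.

(** The walk and the integral differ only through the final carry, of weight at most [2^-m]. *)
Lemma mu_integral_approx (xs : seq bool) (m : nat) (g : int -> R) (M : R) :
  (forall d, `|g d| <= M) ->
  `|\int[mu_ R (val2 (xs ++ nseq m false))]_(d in [set: int]) g d -
    walk (xs ++ nseq m false) (fun _ d _ => g d) false 0 0| <= 2 * M * 2^-1 ^+ m.
Proof.
set ys := xs ++ nseq m false.
(* A one-sided bound, used for [g] and for [- g]. The shift [g + M] has values in [[0, 2M]], whence
   the factor [2 * M]; total mass 1 undoes the shift. *)
have H : forall g : int -> R, (forall d, `|g d| <= M) ->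
    walk ys (fun _ d _ => g d) false 0 0 - 2 * M * 2^-1 ^+ m <=
    \int[mu_ R (val2 ys)]_(d in [set: int]) g d.
  move=> {}g gM.
  have M0 : 0 <= M by rewrite (le_trans _ (gM 0)).
  have gM' d : 0 <= (fun d => g d + M) d <= 2 * M.
    by have := gM d; rewrite ler_norml; lra.
  have := mu_integral_ge ys gM'.
  have E : \int[mu_ R (val2 ys)]_(d in [set: int]) (g d + M) =
      \int[mu_ R (val2 ys)]_(d in [set: int]) g d + M.
    rewrite RintegralD//; last 2 first.
    - exact: (mu_integrable_bounded _ gM).
    - by apply: (@mu_integrable_bounded _ _ M) => d; rewrite ger0_norm.
    congr (_ + _); rewrite Rintegral_cst// [X in fine X](_ : _ = 1%:E) ?mulr1//.
    exact: mu_setT.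
  rewrite E => h; rewrite -(lerD2r M); apply: le_trans h.
  have -> : walk ys (fun _ d _ => g d) false 0 0 - 2 * M * 2^-1 ^+ m + M =
      walk ys (fun _ d _ => g d + M) false 0 0 - 2 * M * 2^-1 ^+ m.
    by rewrite walkD walk_cst; ring.
  apply: (@le_trans _ _ (walk ys (fun c d _ => (g d + M) - 2 * M * c%:R) false 0 0)).
    by rewrite walkB walkZ lerB// ler_wpM2l ?walk_carry_le// mulr_ge0.
  by apply: ler_walk => -[] d _ /=; have := gM' d; rewrite /=; lra.
move=> gM; rewrite ler_distl H//=.
have /H : forall d, `|(fun d => - g d) d| <= M by move=> d; rewrite normrN.
have -> : \int[mu_ R (val2 ys)]_d (- g d) = - \int[mu_ R (val2 ys)]_d g d.
  rewrite -mulN1r -RintegralZl//; last exact: mu_integrable_bounded gM.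
  by apply: eq_Rintegral => d _; rewrite mulN1r.
by rewrite walkN; lra.
Qed.

Lemma integral_mu_tilde (X : nat -> bool) (n : nat) (f : R -> R) (M : R) :
  continuous f -> (forall x, `|f x| <= M) ->
  (\int[@mu_tilde R X n]_x (f x)%:E =
   (\int[mu_ R (aX X n)]_(k in [set: int]) f (rescale R n k))%:E)%E.
Proof.
move=> cf fM.
have I : (mu_ R (aX X n)).-integrable [set: int] (EFin \o (f \o rescale R n)).
  by apply: (@mu_integrable_bounded _ _ M) => d; exact: fM.
rewrite fineK; last exact: integrable_fin_num.
have mr : measurable_fun [set: int] (rescale R n) by [].
have mf : measurable_fun [set: measurableTypeR R] (EFin \o f).
  by apply/measurable_EFinP; exact: continuous_measurable_fun.
have := @integral_pushforward _ _ _ _ R _ mr (mu_ R (aX X n)) setT _ mf I measurableT.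
by [].
Qed.

End carry_walk_law.

(** * Almost every digit sequence *)

Lemma val2_mkseq (X : nat -> bool) (N : nat) :
  val2 (mkseq X N) = (\sum_(k < N) X k * 2 ^ k)%N.
Proof.
elim: N X => [|N IH] X; first by rewrite big_ord0.
have -> : mkseq X N.+1 = X 0%N :: mkseq (fun k => X k.+1) N.
  by rewrite /mkseq /= -[1%N]/(1 + 0)%N iotaDl -map_comp.
rewrite /= IH big_ord_recl expn0 muln1 -muln2 big_distrl/=; congr addn.
by apply: eq_bigr => i _; rewrite /bump/= add1n expnS mulnAC -mulnA.
Qed.

Lemma val2_digits (X : nat -> bool) (n m : nat) :
  val2 (mkseq X n.+1 ++ nseq m false) = aX X n.
Proof.
rewrite /aX -val2_mkseq; elim: (mkseq X n.+1) => [|x s /= ->//].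
by elim: m => //= m ->.
Qed.

Section almost_every_digit_sequence.
Variables (R : realType) (P : probability bitseq_space R).
Hypothesis hP : balanced_bernoulli P.

Definition cylinder (s : seq bool) : set bitseq_space :=
  [set X : nat -> bool | mkseq X (size s) = s].

Lemma cylinderE (s : seq bool) :
  cylinder s = [set X : nat -> bool | forall k, (k < size s)%N -> X k = nth false s k].
Proof.
apply/seteqP; split => X /= h.
  by move=> k ks; rewrite -[in RHS]h nth_mkseq.
apply: (@eq_from_nth _ false); rewrite size_mkseq// => k ks.
by rewrite nth_mkseq ?h.
Qed.

Lemma measurable_coordinate (k : nat) (b : bool) :
  measurable ([set X | X k = b] : set bitseq_space).
Proof. by apply: sub_sigma_algebra; exists k, b. Qed.

Lemma measurable_cylinder (s : seq bool) : measurable (cylinder s).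
Proof.
rewrite cylinderE.
have -> : [set X : nat -> bool | forall k, (k < size s)%N -> X k = nth false s k] =
    \bigcap_(k in `I_(size s)) ([set X | X k = nth false s k] : set bitseq_space).
  by apply/seteqP; split => X.
by apply: bigcap_measurableType => k _; exact: measurable_coordinate.
Qed.

Lemma cylinder_prob (s : seq bool) : P (cylinder s) = ((2 ^+ size s)^-1)%:E.
Proof.
rewrite cylinderE (hP _ (fun k => [set b | b = nth false s k])).
have E b : bernoulli_prob (2^-1 : R) [set c | c = b] = (2^-1)%:E.
  rewrite bernoulli_probE; last by lra.
  rewrite !diracE/=; case: b.
    rewrite mem_set// memNset//= ?mule1 ?mule0 ?adde0//.
  rewrite memNset// mem_set//= mule0 mule1 add0e /unstable.onem; congr EFin; lra.
under eq_bigr do rewrite E.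
rewrite prodEFin prodr_const card_ord exprVn//.
Qed.

(** Exactly one cylinder of length [N] contains [X], so a function of the first [N] digits is a
    finite sum of indicators. *)
Lemma mkseq_indicE (G : seq bool -> R) (N : nat) (X : bitseq_space) :
  G (mkseq X N) = \sum_(s <- words N) G s * \1_(cylinder s) X.
Proof.
rewrite (bigD1_seq (mkseq X N)) ?uniq_words//=; last first.
  by rewrite mem_words size_mkseq.
rewrite big1_seq => [|s /andP[sX]].
  by rewrite indicE mem_set ?mulr1 ?addr0// /cylinder/= size_mkseq.
rewrite mem_words => /eqP sN; rewrite indicE memNset ?mulr0// /cylinder/= sN.
by move/eqP; rewrite eq_sym (negbTE sX).
Qed.

Lemma integral_mkseq (G : seq bool -> R) (N : nat) : (forall s, 0 <= G s) ->
  (\int[P]_X (G (mkseq X N))%:E = (average N G)%:E)%E.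
Proof.
move=> G0.
under eq_integral => X _.
  rewrite mkseq_indicE -sumEFin.
  under eq_bigr do rewrite EFinM.
  over.
rewrite ge0_integral_sum//=; last 2 first.
- move=> s; apply: emeasurable_funM => //; apply/measurable_EFinP.
  by apply: measurable_indic; exact: measurable_cylinder.
- by move=> s X _; rewrite mule_ge0// lee_fin.
rewrite /average mulr_suml -sumEFin.
apply: eq_big_seq => s; rewrite mem_words => /eqP sN.
rewrite ge0_integralZl//=; last 2 first.
- by apply/measurable_EFinP/measurable_indic; exact: measurable_cylinder.
- by rewrite lee_fin.
rewrite integral_indic//; last exact: measurable_cylinder.
by rewrite setIT EFinM -sN; congr (_ * _)%E; exact: cylinder_prob.
Qed.

Lemma measurable_mkseq (G : seq bool -> R) (N : nat) :
  measurable_fun [set: bitseq_space] (fun X : bitseq_space => G (mkseq X N)).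
Proof.
rewrite (funext (mkseq_indicE G N)).
apply: measurable_sum => s; apply: measurable_funM => //.
by apply: measurable_indic; exact: measurable_cylinder.
Qed.

(** The expectations are summable, so the sum of the series is integrable, hence finite almost
    surely, and its terms tend to 0. *)
Lemma fluctuation_cvg0 :
  {ae P, forall X : bitseq_space,
    (fluctuation R (mkseq X n.+1)) @[n --> \oo] --> (0 : R)}.
Proof.
pose g n (X : bitseq_space) : R := fluctuation R (mkseq X n.+1).
have g0 n X : 0 <= g n X by exact: fluctuation_ge0.
have mg n : measurable_fun [set: bitseq_space] (g n) by exact: measurable_mkseq.
(* Comparison with a telescoping series; the factor 6 suffices because [x + 1 <= 2x] for
   [x >= 1]. *)
have bnd n : 3 / n.+1%:R ^+ 2 <= 6 * (n.+1%:R^-1 - n.+2%:R^-1) :> R.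
  have n0 : 0 < n.+1%:R :> R by rewrite ltr0n.
  rewrite -(natr1 n.+1); set x : R := n.+1%:R in n0 *.
  have -> : 6 * (x^-1 - (x + 1)^-1) = (3 / x ^+ 2) * (2 * x / (x + 1)).
    by field; lra.
  have x1 : 1 <= x by rewrite ler1n.
  rewrite ler_pMr ?divr_gt0 ?exprn_gt0// ler_pdivlMr ?mul1r; lra.
have S : (\sum_(n <oo) \int[P]_X (g n X)%:E <= 6%:E)%E.
  apply: lime_le.
    by apply: is_cvg_nneseries => n _ _; apply: integral_ge0 => X _; rewrite lee_fin.
  near=> k.
  rewrite (@le_trans _ _
    (\sum_(0 <= n < k) (6 * (n.+1%:R^-1 - n.+2%:R^-1))%:E)%E)//.
    apply: lee_sum => n _; rewrite /g integral_mkseq; last exact: fluctuation_ge0.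
    by rewrite lee_fin (le_trans _ (bnd n))// average_fluctuation_le.
  rewrite sumEFin lee_fin -mulr_sumr ler_piMr//.
  have -> : \sum_(0 <= i < k) (i.+1%:R^-1 - i.+2%:R^-1) = 1 - k.+1%:R^-1 :> R.
    elim: (k) => [|j IH]; first by rewrite big_geq// invr1 subrr.
    by rewrite big_nat_recr//= IH addrA subrK.
  by rewrite gerBl invr_ge0.
have I : P.-integrable [set: bitseq_space] (fun X => \sum_(n <oo) (g n X)%:E)%E.
  apply/integrableP; split.
    apply: ge0_emeasurable_sum => [n X _ _|n _]; first by rewrite lee_fin.
    exact/measurable_EFinP.
  under eq_integral => X _.
    rewrite gee0_abs; last by apply: nneseries_ge0 => n _ _; rewrite lee_fin.
    over.
  rewrite integral_nneseries//; last 2 first.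
  - by move=> n; exact/measurable_EFinP.
  - by move=> n X _; rewrite lee_fin.
  exact: le_lt_trans S (ltry _).
have := integrable_ae measurableT I.
apply: filterS => X /(_ Logic.I) fX; apply: cvg_series_cvg_0.
apply: nnseries_is_cvg => [n|]; first exact: g0.
by move: fX; rewrite fin_numE => /andP[_]; rewrite -ltey.
Unshelve. all: by end_near. Qed.

End almost_every_digit_sequence.

(** * Quenched convergence of the characteristic functions *)

Section quenched.
Variable R : realType.

Lemma expR_lipschitz (u v w : R) : u <= w -> v <= w ->
  `|expR u - expR v| <= `|u - v| * expR w.
Proof.
wlog uv : u v / u <= v => [H uw vw|_ vw].
  by have [/H->//|/ltW vu] := leP u v; rewrite distrC [`|u - v|]distrC H.
rewrite ler0_norm ?subr_le0 ?ler_expR// ler0_norm ?subr_le0// !opprB.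
apply: (@le_trans _ _ ((v - u) * expR v)); last first.
  by rewrite ler_wpM2l ?subr_ge0// ler_expR.
have -> : expR u = expR v * expR (u - v) by rewrite -expRD; congr expR; ring.
have := expR_ge1Dx (u - v); have := expR_gt0 v.
move: (expR _) (expR _) => a b b0 h.
have -> : b - b * a = (1 - a) * b by ring.
by rewrite ler_pM2r//; lra.
Qed.

Lemma cos_lipschitz (u v : R) : `|cos u - cos v| <= `|u - v|.
Proof.
wlog uv : u v / u < v => [H|].
  by have [/H//|/H h|->] := ltgtP u v; rewrite ?subrr// distrC [`|u - v|]distrC.
have cc : {within `[u, v], continuous (@cos R)}.
  by apply: continuous_subspaceT; exact: continuous_cos.
have [c _ E] := MVT uv (fun x _ => is_derive_cos x) cc.
have -> : cos u - cos v = - sin c * (u - v) by rewrite -opprB E; ring.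
by rewrite normrM normrN ler_piMl// sin_max.
Qed.

Lemma cvg_of_sub_cvg0 (u w : nat -> R) (l : R) :
  (u n - w n @[n --> \oo] --> (0 : R)) -> (w n @[n --> \oo] --> l) ->
  u n @[n --> \oo] --> l.
Proof.
move=> uw wl; rewrite -[l]add0r.
apply: cvg_trans (cvgD uw wl); apply: near_eq_cvg; near=> n.
by rewrite /= subrK.
Unshelve. all: by end_near. Qed.

(** If [|y| > e], then [|y| <= |y| (|y| / e)^3]. This trades an absolute value for the fourth moment
    measured by [fluctuation]. *)
Lemma norm_le_pow4 (y e : R) : 0 < e -> `|y| <= e + y ^+ 4 / e ^+ 3.
Proof.
move=> e0; have [ye|ey] := leP `|y| e.
  rewrite (le_trans ye)// lerDl; apply: divr_ge0; first exact: exprn_even_ge0.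
  by rewrite exprn_ge0// ltW.
rewrite (@le_trans _ _ (y ^+ 4 / e ^+ 3))//; last by rewrite lerDr ltW.
rewrite ler_pdivlMr ?exprn_gt0//.
have -> : y ^+ 4 = `|y| * `|y| ^+ 3.
  by rewrite -exprS -normrX ger0_norm// exprn_even_ge0.
by rewrite ler_wpM2l// lerXn2r ?nnegrE// ltW.
Qed.

(** The exact martingale carries the factor [cos(theta)^-q = exp(al q)] with
    [al = - ln (cos theta)]. Replacing [q] by its typical value [N / 2] turns this factor into
    [exp(v / 2)], and the error is controlled by the deviation of [2q] from [N]. *)
Lemma walk_cos_approx (xs : seq bool) (theta b e v : R) :
  xs != [::] -> 0 < cos theta -> 0 < e -> v = - ln (cos theta) * (size xs)%:R ->
  `|walk xs (fun _ d _ => cos (theta * d%:~R + b)) false 0 0 -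
    expR (- v / 2) * cos b| <=
  v * expR v * (e + fluctuation R xs / e ^+ 3).
Proof.
move=> xs0 k0 e0 vE.
set N : R := (size xs)%:R in vE.
have N0 : 0 < N by rewrite ltr0n lt0n size_eq0.
set al := - ln (cos theta) in vE.
have al0 : 0 <= al by rewrite oppr_ge0 ln_le0// cos_le1.
have kE q : (cos theta)^-1 ^+ q = expR (al * q%:R).
  by rewrite mulrC expRM_natl /al expRN lnK.
(* [cos b] is the mean of the martingale, so the difference becomes the mean of a pointwise
   difference. *)
have := walk_cos xs b false 0 0 (lt0r_neq0 k0).
rewrite mulr0 add0r expr0 mulr1 => <-.
rewrite -walkZ -walkB (le_trans (ler_norm_walk _ _ _ _ _))//.
rewrite (@le_trans _ _ (walk xs (fun _ _ q => v * expR v *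
   (e + ((2 * q%:R - N) / N) ^+ 4 / e ^+ 3)) false 0 0))//; last first.
  rewrite walkZ ler_wpM2l ?mulr_ge0 ?expR_ge0 ?vE ?mulr_ge0 ?(ltW N0)//.
  rewrite walkD walk_cst lerD2l /fluctuation mulrC -walkZ.
  by apply: ler_walk => _ _ q; rewrite mulrC.
(* The restriction [q <= N] keeps the exponent [al (q - N / 2)] below [v], as the Lipschitz bound
   for the exponential requires. *)
rewrite (@eq_walk_reach _ _ _ (fun _ d q => if (q <= size xs)%N then
  `|cos (theta * d%:~R + b) - expR (- v / 2) *
   (cos (theta * d%:~R + b) * (cos theta)^-1 ^+ q)| else 0)); last first.
  by move=> c' d' q' _ /andP[_]; rewrite add0n => ->.
apply: ler_walk => _ d q.
have v0 : 0 <= v by rewrite vE mulr_ge0 ?(ltW N0).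
have R0 : 0 <= v * expR v * (e + ((2 * q%:R - N) / N) ^+ 4 / e ^+ 3).
  apply: mulr_ge0; first by rewrite mulr_ge0 ?expR_ge0.
  apply: addr_ge0; first exact: ltW.
  by apply: divr_ge0; [exact: exprn_even_ge0|rewrite exprn_ge0// ltW].
case: ifP => // qN; rewrite kE.
have -> : cos (theta * d%:~R + b) - expR (- v / 2) *
    (cos (theta * d%:~R + b) * expR (al * q%:R)) =
    cos (theta * d%:~R + b) * (expR 0 - expR (al * (q%:R - N / 2))).
  have -> : expR (al * (q%:R - N / 2)) = expR (- v / 2) * expR (al * q%:R).
    by rewrite -expRD; congr expR; rewrite vE; field.
  by rewrite expR0; ring.
rewrite normrM (@le_trans _ _ (`|expR 0 - expR (al * (q%:R - N / 2))|))//.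
  by rewrite ler_piMl// cos_max.
have qN' : q%:R <= N by rewrite ler_nat.
rewrite (le_trans (@expR_lipschitz _ _ v _ _))//.
  by rewrite vE ler_wpM2l//; lra.
rewrite mulrAC ler_wpM2r ?expR_ge0//.
rewrite sub0r normrN normrM (ger0_norm al0) vE -mulrA ler_wpM2l//.
have -> : q%:R - N / 2 = (2 * q%:R - N) / N * (N / 2) by field; lra.
rewrite normrM [leLHS]mulrC (ger0_norm (_ : 0 <= N / 2)); last by lra.
rewrite (@le_trans _ _ (N * `|(2 * q%:R - N) / N|))//.
  by rewrite ler_wpM2r//; lra.
by rewrite ler_wpM2l ?(ltW N0)// norm_le_pow4.
Qed.

(** * Asymptotics at the rescaled frequency and convergence of the characteristic functions *)

Lemma sinc_cvg1 : (sin h / h) @[h --> 0^'] --> (1 : R).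
Proof.
have [d dE] := is_derive_sin (0 : R).
have : h^-1 *: (sin (h *: (1:R) + 0) - sin 0) @[h --> (0:R)^'] --> 'D_1 (@sin R) 0.
  exact: d.
rewrite dE cos0; apply: cvg_trans; apply: near_eq_cvg; near=> h.
by rewrite /= sin0 subr0 addr0 /GRing.scale/= mulr1 mulrC.
Unshelve. all: by end_near. Qed.

Definition angle (t : R) (n : nat) : R := t * Num.sqrt (2 / n%:R).

Lemma sqr_angle (t : R) (n : nat) : angle t n ^+ 2 = t ^+ 2 * (2 / n%:R).
Proof. by rewrite exprMn sqr_sqrtr// divr_ge0. Qed.

Lemma angle_cvg0 (t : R) : angle t n @[n --> \oo] --> (0 : R).
Proof.
apply/cvgr0Pnorm_le => e e0; near=> n.
have n0 : 0 < n%:R :> R by rewrite ltr0n; near: n; exact: nbhs_infty_gt.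
have nt : t ^+ 2 * 2 / e ^+ 2 <= n%:R by near: n; exact: nbhs_infty_ger.
rewrite -(@ler_pXn2r _ 2) ?nnegrE ?(ltW e0)//.
rewrite -normrX ger0_norm ?sqr_ge0// sqr_angle mulrA ler_pdivrMr// mulrC.
by rewrite [leLHS]mulrC [leRHS]mulrC -ler_pdivrMr ?exprn_gt0.
Unshelve. all: by end_near. Qed.

(** With [x] the angle, [1 - cos x = 2 sin(x/2)^2], [sin h / h] tends to 1 and [x^2 n / 2 = t^2].
    The factor [n.+1] is the number of digits of [aX X n], and [(n + 1) / n] tends to 1. *)
Lemma mul_sub1cos_angle (t : R) :
  (1 - cos (angle t n)) * n.+1%:R @[n --> \oo] --> t ^+ 2.
Proof.
have [->|t0] := eqVneq t 0.
  under eq_fun do rewrite /angle mul0r cos0 subrr mul0r.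
  by rewrite expr0n; exact: cvg_cst.
(* The index 0, where [2 / 0 = 0] makes the angle vanish, is skipped so that division by the angle
   is legitimate. *)
rewrite -cvg_shiftS/=.
have a0 n : angle t n.+1 / 2 != 0.
  by rewrite mulf_neq0// mulf_neq0// sqrtr_eq0 -ltNge divr_gt0.
have ac : angle t n.+1 / 2 @[n --> \oo] --> (0 : R).
  rewrite -(mul0r 2^-1); apply: cvgM; last exact: cvg_cst.
  by rewrite (cvg_shiftS (angle t)); exact: angle_cvg0.
have sc : sin (angle t n.+1 / 2) / (angle t n.+1 / 2) @[n --> \oo] --> (1 : R).
  by move/cvgr_dnbhsP : sinc_cvg1 => /(_ _ (conj a0 ac)).
have rc : 1 + n.+1%:R^-1 @[n --> \oo] --> (1 : R).
  by rewrite -[X in _ --> X]addr0; apply: cvgD; [exact: cvg_cst|exact: cvg_harmonic].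
have alg (x N s : R) : x != 0 -> N != 0 ->
    x ^+ 2 * N / 2 * (s / (x / 2) * (s / (x / 2))) * (1 + N^-1) =
    (1 - (1 - 2 * s ^+ 2)) * (N + 1).
  by move=> x0 N0; field; rewrite ?x0 ?N0.
have -> : t ^+ 2 = t ^+ 2 * (1 * 1) * 1 by rewrite !mulr1.
apply: cvg_trans (cvgM (cvgM (cvg_cst _) (cvgM sc sc)) rc).
apply: near_eq_cvg; near=> n; rewrite /=.
have n0 : n.+1%:R != 0 :> R by rewrite pnatr_eq0.
set x := angle t n.+1.
have x2 : x ^+ 2 = t ^+ 2 * (2 / n.+1%:R) by rewrite sqr_angle.
have x0 : x != 0 by have := a0 n; apply: contra => /eqP; rewrite /x => ->; rewrite mul0r.
have -> : cos x = 1 - 2 * sin (x / 2) ^+ 2.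
  have xE : x = (x / 2) *+ 2 by rewrite -mulr_natr; field.
  by rewrite {1}xE cos_mulr2n cos2sin2 -mulr_natr; ring.
rewrite -[n.+2%:R]natr1 -[n.+1%:R]/(n.+1%:R).
set s := sin _; set N : R := n.+1%:R in n0 x2 *.
have -> : t ^+ 2 = x ^+ 2 * N / 2 by rewrite x2; field.
by apply: alg.
Unshelve. all: by end_near. Qed.

Lemma cos_angle_cvg1 (t : R) : cos (angle t n) @[n --> \oo] --> (1 : R).
Proof.
rewrite -cos0; apply: continuous_cvg; first exact: continuous_cos.
exact: angle_cvg0.
Qed.

(** Squeeze by [1 - k <= - ln k <= (1 - k) / k] for [k = cos (angle t n) > 0]. *)
Lemma mul_ln_cos_angle (t : R) :
  - ln (cos (angle t n)) * n.+1%:R @[n --> \oo] --> t ^+ 2.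
Proof.
have c1 := @cos_angle_cvg1 t; have c2 := @mul_sub1cos_angle t.
have c3 : (1 - cos (angle t n)) * n.+1%:R / cos (angle t n) @[n --> \oo] --> t ^+ 2.
  rewrite -[X in _ --> X]divr1; apply: cvgM => //.
  by apply: cvgV => //; exact: oner_neq0.
apply: squeeze_cvgr c2 c3; near=> n.
have k0 : 0 < cos (angle t n).
  near: n; move/cvgrPdist_lt : c1 => /(_ _ ltr01); apply: filterS => n.
  by rewrite ltr_norml => /andP[_]; lra.
move: (cos _) k0 => k k0; rewrite mulrAC !ler_pM2r// lerNr opprB.
apply/andP; split.
  by have := @le_ln1Dx _ (k - 1); rewrite (_ : 1 + (k - 1) = k); [apply; lra|ring].
have := @le_ln1Dx _ (k^-1 - 1); rewrite (_ : 1 + (k^-1 - 1) = k^-1); last by ring.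
rewrite lnV// => h.
rewrite (le_trans (h _))//; first by rewrite ltrBrDl subrr invr_gt0.
by rewrite mulrBl mul1r divff ?gt_eqF.
Unshelve. all: by end_near. Qed.

Lemma walk_cos_cvg (xs : nat -> seq bool) (t b : R) :
  (forall n, size (xs n) = n.+1) ->
  (fluctuation R (xs n) @[n --> \oo] --> (0 : R)) ->
  walk (xs n) (fun _ d _ => cos (angle t n * d%:~R + b)) false 0 0 @[n --> \oo] -->
  expR (- t ^+ 2 / 2) * cos b.
Proof.
move=> sxs g0.
pose v n : R := - ln (cos (angle t n)) * n.+1%:R.
have vc : v n @[n --> \oo] --> t ^+ 2 := @mul_ln_cos_angle t.
have lim2 : expR (- v n / 2) * cos b @[n --> \oo] --> expR (- t ^+ 2 / 2) * cos b.
  apply: cvgM; last exact: cvg_cst.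
  apply: continuous_cvg; first exact: continuous_expR.
  by apply: cvgM; [exact: cvgN|exact: cvg_cst].
apply: cvg_of_sub_cvg0 lim2; apply/cvgr0Pnorm_le => e e0.
(* [A] bounds [v n] eventually. With [fluctuation <= h^4] the error is at most [A exp(A) * 2h],
   which equals [e] for the [h] chosen next. *)
pose A := t ^+ 2 + 1; have A0 : 0 < A by rewrite ltr_wpDl ?sqr_ge0.
pose h := e / (2 * A * expR A).
have h0 : 0 < h by rewrite divr_gt0// !mulr_gt0// expR_gt0.
near=> n.
have k0 : 0 < cos (angle t n).
  near: n; move/cvgrPdist_lt : (@cos_angle_cvg1 t) => /(_ _ ltr01).
  by apply: filterS => n; rewrite ltr_norml => /andP[_]; lra.
have gh : fluctuation R (xs n) <= h ^+ 4.
  rewrite (le_trans (ler_norm _))//; near: n.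
  by move/cvgr0Pnorm_le : g0; apply; rewrite exprn_gt0.
have vA : v n <= A.
  near: n; move/cvgrPdist_le : vc => /(_ _ ltr01).
  by apply: filterS => n; rewrite ler_norml /A => /andP[]; lra.
have xs0 : xs n != [::] by rewrite -size_eq0 sxs.
have vE : v n = - ln (cos (angle t n)) * (size (xs n))%:R by rewrite sxs.
rewrite (le_trans (walk_cos_approx b xs0 k0 h0 vE))//.
have v0 : 0 <= v n by rewrite mulr_ge0// oppr_ge0 ln_le0// cos_le1.
apply: (@le_trans _ _ (A * expR A * (h + h ^+ 4 / h ^+ 3))).
  apply: ler_pM.
  - by rewrite mulr_ge0 ?expR_ge0.
  - apply: addr_ge0; first exact: ltW.
    by rewrite divr_ge0 ?fluctuation_ge0// exprn_ge0// ltW.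
  - by apply: ler_pM => //; rewrite ?expR_ge0// ler_expR.
  by rewrite lerD2l ler_wpM2r// invr_ge0 exprn_ge0// ltW.
have -> : h + h ^+ 4 / h ^+ 3 = 2 * h by field; lra.
have eA := expR_gt0 A.
by rewrite /h le_eqVlt; apply/orP; left; apply/eqP; field; rewrite !gt_eqF.
Unshelve. all: by end_near. Qed.

(** The [m] padding digits move the variation by at most [m], and the cosine is 1-Lipschitz. For
    fixed [m] the padding is thus harmless as [theta] tends to 0. *)
Lemma walk_nseq_cos (xs : seq bool) (m : nat) (theta b : R) :
  `|walk (xs ++ nseq m false) (fun _ d _ => cos (theta * d%:~R + b)) false 0 0 -
    walk xs (fun _ d _ => cos (theta * d%:~R + b)) false 0 0| <= `|theta| * m%:R.
Proof.
rewrite walk_cat -walkB (le_trans (ler_norm_walk _ _ _ _ _))//.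
rewrite -[leRHS](walk_cst xs _ false 0 0); apply: ler_walk => c d q.
rewrite -[X in _ - X](walk_cst (nseq m false) _ c d q) -walkB.
rewrite (le_trans (ler_norm_walk _ _ _ _ _))//.
rewrite -[leRHS](walk_cst (nseq m false) _ c d q).
rewrite (@eq_walk_reach _ _ _ (fun _ d' _ => if `|d' - d| <= m%:Z then
  `|cos (theta * d'%:~R + b) - cos (theta * d%:~R + b)| else 0)); last first.
  by move=> c' d' q' h /andP[_]; rewrite size_nseq => h'; rewrite ifT//; lia.
apply: ler_walk => _ d' _; case: ifP => [dm|_]; last by rewrite mulr_ge0.
rewrite (le_trans (cos_lipschitz _ _))//.
have -> : theta * d'%:~R + b - (theta * d%:~R + b) = theta * (d' - d)%:~R.
  by rewrite rmorphB/=; ring.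
rewrite normrM ler_wpM2l// -intr_norm.
by rewrite -[m%:R]/(m%:Z%:~R) ler_int.
Qed.

Lemma walk_cos_cvg_nseq (xs : nat -> seq bool) (m : nat) (t b : R) :
  (forall n, size (xs n) = n.+1) ->
  (fluctuation R (xs n) @[n --> \oo] --> (0 : R)) ->
  walk (xs n ++ nseq m false) (fun _ d _ => cos (angle t n * d%:~R + b)) false 0 0
    @[n --> \oo] --> expR (- t ^+ 2 / 2) * cos b.
Proof.
move=> sxs g0; have c := @walk_cos_cvg xs t b sxs g0.
apply: cvg_of_sub_cvg0 c; apply/norm_cvg0P.
have am : `|angle t n| * m%:R @[n --> \oo] --> (0 : R).
  rewrite -(mul0r m%:R); apply: cvgM; last exact: cvg_cst.
  by rewrite -(normr0 R); apply: cvg_norm; exact: angle_cvg0.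
apply: (squeeze_cvgr _ (cvg_cst 0) am); near=> n.
by rewrite normr_ge0/= walk_nseq_cos.
Unshelve. all: by end_near. Qed.

End quenched.

(** * The normal law *)

Section gaussian.
Variable R : realType.
Local Notation mu := (@lebesgue_measure R).
Local Notation phi := (normal_pdf (0 : R) 1).

Lemma normal_pdf01E (x : R) : phi x = normal_peak 1 * expR (- x ^+ 2 / 2).
Proof.
by rewrite normal_pdfE ?oner_neq0// /normal_fun subr0 expr1n.
Qed.

(** [phi] agrees almost everywhere with the Radon-Nikodym derivative, both having the same integral
    over every measurable set. *)
Lemma integral_normal_prob (f : R -> R) (M : R) :
  measurable_fun [set: R] f -> (forall x, `|f x| <= M) ->
  (\int[normal_prob (0 : R) 1]_x (f x)%:E = \int[mu]_x (f x * phi x)%:E)%E.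
Proof.
move=> mf fM.
have M0 : 0 <= M by exact: le_trans (fM 0).
have dom := normal_prob_dominates (0 : R) 1.
have I : (normal_prob (0 : R) 1).-integrable [set: R] (EFin \o f).
  apply/integrableP; split; first exact/measurable_EFinP.
  rewrite (@le_lt_trans _ _ (\int[normal_prob (0 : R) 1]_x M%:E)%E)//.
    apply: ge0_le_integral => //= [|x _]; last by rewrite lee_fin.
    by apply/measurable_EFinP; exact: measurableT_comp.
  by rewrite integral_cst//= probability_setT mule1 ltry.
rewrite -(Radon_Nikodym_change_of_variables dom)//=.
apply: ae_eq_integral => //.
- apply: emeasurable_funM; first exact/measurable_EFinP.
  apply: (measurable_int mu).
  by apply: Radon_Nikodym_integrable; exact: dom.
- apply/measurable_EFinP; apply: measurable_funM => //.
  exact: measurable_normal_pdf.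
- under [X in ae_eq _ _ _ X]eq_fun do rewrite EFinM.
  apply: ae_eqe_mul2l => /=.
  rewrite Radon_NikodymE//=.
  case: cid => /= h [h1 h2 h3].
  apply: integral_ae_eq => //=.
    by apply/measurable_EFinP; exact: measurable_normal_pdf.
  by move=> E _ mE; rewrite -h3.
Qed.

(** Half of the exponent absorbs the square, by [x^2 / 4 <= exp(x^2 / 4)]; the other half is the
    exponent of the normal density of variance 2. Integrability of the second moment follows by
    comparison. *)
Lemma sqr_normal_pdf_le : exists C : R,
  forall x : R, x ^+ 2 * phi x <= C * normal_pdf 0 (Num.sqrt 2) x.
Proof.
have s2 : Num.sqrt 2 != 0 :> R by rewrite sqrtr_eq0 -ltNge.
exists (4 * (normal_peak 1 / normal_peak (Num.sqrt 2))) => x.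
rewrite normal_pdf01E normal_pdfE// /normal_fun subr0 sqr_sqrtr//.
have p0 : normal_peak (Num.sqrt 2) != 0 :> R by rewrite gt_eqF// normal_peak_gt0.
have -> : 4 * (normal_peak 1 / normal_peak (Num.sqrt 2)) *
  (normal_peak (Num.sqrt 2) * expR (- x ^+ 2 / (2 *+ 2))) =
  normal_peak 1 * (4 * expR (- x ^+ 2 / (2 *+ 2))) :> R by field.
rewrite mulrCA ler_wpM2l ?normal_peak_ge0//.
have -> : - x ^+ 2 / 2 = - x ^+ 2 / (2 *+ 2) + - x ^+ 2 / (2 *+ 2) by field.
rewrite expRD mulrA ler_wpM2r ?expR_ge0//.
have -> : - x ^+ 2 / (2 *+ 2) = - (x ^+ 2 / 4) by field.
rewrite expRN ler_pdivrMr ?expR_gt0//.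
have := expR_ge1Dx (x ^+ 2 / 4); have := sqr_ge0 x; lra.
Qed.

Lemma integrable_sqr_normal_pdf :
  mu.-integrable [set: R] (fun x => (x ^+ 2 * phi x)%:E).
Proof.
have [C CP] := sqr_normal_pdf_le.
apply: (@le_integrable _ _ _ mu _ measurableT _
  (fun x => C%:E * (normal_pdf 0 (Num.sqrt 2) x)%:E)%E).
- apply/measurable_EFinP; apply: measurable_funM => //; exact: measurable_normal_pdf.
- move=> x _; rewrite -EFinM !abse_EFin lee_fin ger0_norm; last first.
    by rewrite mulr_ge0 ?sqr_ge0// normal_pdf_ge0.
  exact: le_trans (CP x) (ler_norm _).
- by apply: integrableZl => //; exact: integrable_normal_pdf.
Qed.

Lemma integrable_normal_pdf_mul (g : R -> R) (K : R) :
  measurable_fun [set: R] g -> (forall x, `|g x| <= K * (1 + x ^+ 2)) ->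
  mu.-integrable [set: R] (fun x => (g x * phi x)%:E).
Proof.
move=> mg gK.
have bnd (x : R) : `|g x * phi x| <= K * (phi x + x ^+ 2 * phi x).
  rewrite normrM [X in _ * X]ger0_norm ?normal_pdf_ge0//.
  rewrite -[X in _ * (X + _)]mul1r -mulrDl mulrA.
  by rewrite ler_wpM2r ?normal_pdf_ge0.
apply: (@le_integrable _ _ _ mu _ measurableT _
  (fun x => K%:E * ((phi x)%:E + (x ^+ 2 * phi x)%:E))%E).
- apply/measurable_EFinP; apply: measurable_funM => //; exact: measurable_normal_pdf.
- move=> x _; rewrite -EFinD -EFinM !abse_EFin lee_fin.
  exact: le_trans (bnd x) (ler_norm _).
- apply: integrableZl => //; apply: integrableD => //.
    exact: integrable_normal_pdf.
  exact: integrable_sqr_normal_pdf.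
Qed.

(** * Characteristic function of the normal law *)

Lemma is_derive_normal_pdf (x : R) : is_derive x 1 phi (- x * phi x).
Proof.
have -> : phi = fun x => normal_peak 1 * expR (- x ^+ 2 / 2).
  by apply/funext => y; rewrite normal_pdf01E.
apply: is_derive_eq.
by rewrite -![_ *: _]/(_ * _); field.
Qed.

(** A crude decay, enough to kill the boundary terms of the integration by parts. *)
Lemma normal_pdf_le (n : nat) : phi n.+1%:R <= 2 * normal_peak 1 * n.+1%:R^-1.
Proof.
have n0 : 1 <= n.+1%:R :> R by rewrite ler1n.
rewrite normal_pdf01E -mulrA mulrCA ler_wpM2l ?normal_peak_ge0//.
set x : R := n.+1%:R in n0 *.
have -> : - x ^+ 2 / 2 = - (x ^+ 2 / 2) by rewrite mulNr.
rewrite expRN -[leRHS]invrK invfM invrK lef_pV2 ?posrE ?expR_gt0//; last by lra.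
by have := expR_ge1Dx (x ^+ 2 / 2); rewrite !expr2; nra.
Qed.

Lemma is_derive_normal_sin (a b x : R) :
  is_derive x 1 (fun x => phi x * sin (a * x + b))
    ((- x * sin (a * x + b) + a * cos (a * x + b)) * phi x).
Proof.
have dphi := is_derive_normal_pdf x.
have ds : is_derive x 1 (fun x : R => sin (a * x + b)) (a * cos (a * x + b)).
  apply: is_derive_eq.
  by rewrite -![_ *: _]/(_ * _); ring.
have := is_deriveM dphi ds; move=> /is_derive_eq; apply.
by rewrite -![_ *: _]/(_ * _); ring.
Qed.

Lemma continuous_sin_affine (a b : R) : continuous (fun x : R => sin (a * x + b)).
Proof.
move=> x; apply: (@continuous_comp R R R (fun x => a * x + b) (@sin R)).
  by apply: cvgD; [apply: cvgM => //; exact: cvg_cst|exact: cvg_cst].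
exact: continuous_sin.
Qed.

Lemma continuous_cos_affine (a b : R) : continuous (fun x : R => cos (a * x + b)).
Proof.
move=> x; apply: (@continuous_comp R R R (fun x => a * x + b) (@cos R)).
  by apply: cvgD; [apply: cvgM => //; exact: cvg_cst|exact: cvg_cst].
exact: continuous_cos.
Qed.

Lemma normr_le_1Dsqr (x : R) : `|x| <= 1 + x ^+ 2.
Proof.
rewrite ler_norml; have := sqr_ge0 (x - 1); have := sqr_ge0 (x + 1).
by rewrite !expr2; nra.
Qed.

Lemma integrable_sin_normal_pdf (a b : R) :
  mu.-integrable [set: R] (fun x => (- x * sin (a * x + b) * phi x)%:E).
Proof.
apply: (@integrable_normal_pdf_mul _ 1).
  apply: continuous_measurable_fun => x; apply: cvgM; first exact: cvgN.
  exact: continuous_sin_affine.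
move=> x; rewrite mul1r normrM normrN (le_trans _ (normr_le_1Dsqr x))//.
by rewrite ler_piMr// sin_max.
Qed.

Lemma integrable_cos_normal_pdf (a b c : R) :
  mu.-integrable [set: R] (fun x => (c * cos (a * x + b) * phi x)%:E).
Proof.
apply: (@integrable_normal_pdf_mul _ `|c|).
  apply: continuous_measurable_fun => x; apply: cvgM; first exact: cvg_cst.
  exact: continuous_cos_affine.
move=> x; rewrite normrM ler_wpM2l// (le_trans (cos_max _))//.
by rewrite lerDl sqr_ge0.
Qed.

Lemma continuous_normal_sin' (a b : R) :
  continuous (fun x : R => (- x * sin (a * x + b) + a * cos (a * x + b)) * phi x).
Proof.
move=> x; apply: cvgM; last by apply: continuous_normal_pdf; exact: oner_neq0.
apply: cvgD; apply: cvgM; [exact: cvgN| |exact: cvg_cst|].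
  exact: continuous_sin_affine.
exact: continuous_cos_affine.
Qed.

Lemma integrable_normal_sin' (a b : R) :
  mu.-integrable [set: R]
    (fun x => ((- x * sin (a * x + b) + a * cos (a * x + b)) * phi x)%:E).
Proof.
under eq_fun do rewrite mulrDl EFinD.
apply: integrableD => //; first exact: integrable_sin_normal_pdf.
exact: integrable_cos_normal_pdf.
Qed.

(** The integrand is the derivative of [phi x * sin (a * x + b)]. It is integrated over growing
    symmetric intervals: the integrals converge by domination and the boundary values tend to 0. *)
Lemma integral_normal_by_parts (a b : R) :
  \int[mu]_x ((- x * sin (a * x + b) + a * cos (a * x + b)) * phi x) = 0.
Proof.
pose h (x : R) := (- x * sin (a * x + b) + a * cos (a * x + b)) * phi x.
pose H (x : R) := phi x * sin (a * x + b).
pose I (n : nat) : set R := `[(- n.+1%:R), n.+1%:R]%classic.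
have ih : mu.-integrable [set: R] (EFin \o h) := integrable_normal_sin' a b.
have hI n : (\int[mu]_x (((EFin \o h) \_ (I n)) x) = (H n.+1%:R - H (- n.+1%:R))%:E)%E.
  rewrite -integral_mkcond EFinB; apply: continuous_FTC2.
  - by rewrite (@lt_trans _ _ 0)// ?oppr_lt0 ltr0n.
  - by apply: continuous_subspaceT; exact: continuous_normal_sin'.
  - have dH (x : R) : derivable H x 1 by have [] := is_derive_normal_sin a b x.
    have cH : continuous H.
      by move=> x; apply: differentiable_continuous; exact/derivable1_diffP.
    split => [x _//||]; [apply: cvg_at_right_filter|apply: cvg_at_left_filter];
      exact: cH.
  - by move=> x _; rewrite derive1E; have [_ ->] := is_derive_normal_sin a b x.
have c1 : (\int[mu]_x (((EFin \o h) \_ (I n)) x))%E @[n --> \oo] -->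
    (\int[mu]_x (h x)%:E)%E.
  apply: (@dominated_cvg _ _ _ mu _ measurableT _ _ (fun x => `|(h x)%:E|%E)).
  - move=> n; apply/(measurable_restrictT _ _).1; first exact: measurable_itv.
    by apply: measurable_funTS; case/integrableP: ih.
  - move=> x _; apply: cvg_near_cst; near=> n.
    rewrite patchE mem_set//= /I/= in_itv/= -ler_norml.
    have : `|x| <= n%:R by near: n; exact: nbhs_infty_ger.
    by move/le_trans; apply; rewrite ler_nat.
  - by move=> x _.
  - exact: integrable_abse ih.
  - by move=> n x _; rewrite patchE; case: ifP => _ //=; rewrite normr0 lee_fin.
have c2 : (H n.+1%:R - H (- n.+1%:R))%:E @[n --> \oo] --> (0 : R)%:E.
  apply: cvg_EFin; first exact: nearW.
  have HC x n : x = n.+1%:R \/ x = - n.+1%:R ->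
      `|H x| <= 2 * normal_peak 1 * n.+1%:R^-1.
    move=> xn; rewrite /H normrM [X in X * _]ger0_norm ?normal_pdf_ge0//.
    rewrite (@le_trans _ _ (phi x))//; first by rewrite ler_piMr ?normal_pdf_ge0// sin_max.
    have -> : phi x = phi n.+1%:R by case: xn => ->; rewrite !normal_pdf01E// sqrrN.
    exact: normal_pdf_le.
  have z : 2 * (2 * normal_peak 1) * n.+1%:R^-1 @[n --> \oo] --> (0 : R).
    rewrite -[X in _ --> X](mulr0 (2 * (2 * normal_peak 1))).
    by apply: cvgM; [exact: cvg_cst|exact: cvg_harmonic].
  apply/norm_cvg0P; apply: (squeeze_cvgr _ (cvg_cst 0) z); near=> n.
  rewrite normr_ge0/= (le_trans (ler_normB _ _))// -mulrA mulrDl mul1r lerD//;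
    apply: HC; by [left|right].
have : (\int[mu]_x (h x)%:E = 0%:E)%E.
  by move: c1; rewrite (funext hI) => c1; apply: cvg_unique c1 c2.
by rewrite /Rintegral => ->.
Unshelve. all: by end_near. Qed.

Lemma derive_normal_cos (a b : R) :
  is_derive a 1 (fun t => \int[mu]_x (cos (t * x + b) * phi x))
   (\int[mu]_x (- x * sin (a * x + b) * phi x)).
Proof.
pose f (t x : R) := cos (t * x + b) * phi x.
have df (t x : R) : is_derive t 1 (f ^~ x) (- x * sin (t * x + b) * phi x).
  have dc : is_derive t 1 (fun t : R => cos (t * x + b)) (- x * sin (t * x + b)).
    by apply: is_derive_eq; rewrite -![_ *: _]/(_ * _); ring.
  have := is_deriveM dc (is_derive_cst (phi x) t (1 : R)); move=> /is_derive_eq; apply.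
  by rewrite /cst -![_ *: _]/(_ * _); ring.
have f1 t x : partial1of2 f t x = - x * sin (t * x + b) * phi x.
  by rewrite partial1of2E; have [_ ->] := df t x.
have Ia : `](a - 1), (a + 1)[%classic a by rewrite /= in_itv/=; apply/andP; split; lra.
have intf (t : R) : `](a - 1), (a + 1)[%classic t -> mu.-integrable [set: R] (EFin \o f t).
  move=> _; have := integrable_cos_normal_pdf t b 1.
  by under eq_fun do rewrite mul1r.
have derf (t x : R) : `](a - 1), (a + 1)[%classic t -> [set: R] x -> derivable (f ^~ x) t 1.
  by move=> _ _; have [] := df t x.
(* An integrable bound for the derivative in the parameter, uniform in that parameter. *)
pose G (x : R) := (1 + x ^+ 2) * phi x.
have G0 x : 0 <= G x by rewrite mulr_ge0 ?normal_pdf_ge0// addr_ge0 ?sqr_ge0.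
have iG : mu.-integrable [set: R] (EFin \o G).
  apply: (@integrable_normal_pdf_mul _ 1).
    by apply: measurable_funD => //; exact: measurable_funX.
  by move=> x; rewrite mul1r ger0_norm// addr_ge0 ?sqr_ge0.
have fG (t x : R) : `](a - 1), (a + 1)[%classic t -> [set: R] x ->
    `|partial1of2 f t x| <= G x.
  move=> _ _; rewrite f1 normrM [X in _ * X]ger0_norm ?normal_pdf_ge0//.
  rewrite ler_wpM2r ?normal_pdf_ge0// normrM normrN.
  rewrite (@le_trans _ _ `|x|)//; first by rewrite ler_piMr// sin_max.
  exact: normr_le_1Dsqr.
apply: DeriveDef.
  exact: (derivable_under_integral measurableT Ia intf derf G0 iG fG).
rewrite -derive1E (differentiation_under_integral measurableT Ia intf derf G0 iG fG).
by apply: eq_Rintegral => x _; rewrite f1.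
Qed.

(** By differentiation under the integral and integration by parts, the left side [F] solves
    [F' = - t F]. So [exp(t^2 / 2) F(t)] is constant, equal to its value [cos b] at 0. *)
Lemma integral_normal_cos (t b : R) :
  \int[mu]_x (cos (t * x + b) * phi x) = expR (- t ^+ 2 / 2) * cos b.
Proof.
pose F (t : R) := \int[mu]_x (cos (t * x + b) * phi x).
have dF (a : R) : is_derive a 1 F (- a * F a).
  apply: is_derive_eq (derive_normal_cos a b) _.
  have /eqP := integral_normal_by_parts a b.
  under eq_Rintegral do rewrite mulrDl.
  rewrite RintegralD//; last 2 first.
  - exact: integrable_sin_normal_pdf.
  - exact: integrable_cos_normal_pdf.
  under [X in _ + X]eq_Rintegral do rewrite -mulrA.
  rewrite RintegralZl//; first by rewrite addr_eq0 => /eqP ->; rewrite mulNr.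
  have := integrable_cos_normal_pdf a b 1.
  by under eq_fun do rewrite mul1r.
pose E (t : R) := expR (t ^+ 2 / 2) * F t.
have dE (a : R) : is_derive a 1 E 0.
  have d2 : is_derive a 1 (fun t : R => expR (t ^+ 2 / 2)) (a * expR (a ^+ 2 / 2)).
    by apply: is_derive_eq; rewrite -![_ *: _]/(_ * _); field.
  have := is_deriveM d2 (dF a); move=> /is_derive_eq; apply.
  by rewrite -![_ *: _]/(_ * _); ring.
have E0 : E t = E 0 := is_derive_0_is_cst t 0 dE.
have F0 : F 0 = cos b.
  rewrite /F; under eq_Rintegral do rewrite mul0r add0r.
  rewrite RintegralZl//; last exact: integrable_normal_pdf.
  by rewrite /Rintegral integral_normal_pdf mulr1.
move: E0; rewrite /E F0 expr0n mul0r expR0 mul1r => <-.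
by rewrite mulrA -expRD mulNr addNr expR0 mul1r.
Qed.

End gaussian.

(** * Trigonometric approximation *)

Section trigonometric_approximation.
Variable R : realType.

(** Each triple holds an amplitude, a frequency and a phase; the free phase stands in for sines and
    complex exponentials. *)
Definition trig_poly (p : R -> R) : Prop :=
  exists s : seq (R * R * R),
    forall x, p x = \sum_(c <- s) c.1.1 * cos (c.1.2 * x + c.2).

Lemma trig_poly_cst (k : R) : trig_poly (fun _ => k).
Proof. by exists [:: (k, 0, 0)] => x; rewrite big_seq1/= mul0r addr0 cos0 mulr1. Qed.

Lemma trig_polyD p q : trig_poly p -> trig_poly q -> trig_poly (fun x => p x + q x).
Proof.
by move=> [s sp] [r rq]; exists (s ++ r) => x; rewrite big_cat/= sp rq.
Qed.

Lemma trig_polyZ (k : R) p : trig_poly p -> trig_poly (fun x => k * p x).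
Proof.
move=> [s sp]; exists [seq (k * c.1.1, c.1.2, c.2) | c <- s] => x.
by rewrite sp big_map mulr_sumr; apply: eq_bigr => c _; rewrite mulrA.
Qed.

Lemma trig_poly_mulcos (w b : R) p :
  trig_poly p -> trig_poly (fun x => cos (w * x + b) * p x).
Proof.
move=> [s sp]; exists ([seq (c.1.1 / 2, c.1.2 + w, c.2 + b) | c <- s] ++
  [seq (c.1.1 / 2, c.1.2 - w, c.2 - b) | c <- s]) => x.
rewrite sp big_cat/= !big_map mulr_sumr -big_split/=; apply: eq_bigr => c _.
have -> : (c.1.2 + w) * x + (c.2 + b) = (c.1.2 * x + c.2) + (w * x + b) by ring.
have -> : (c.1.2 - w) * x + (c.2 - b) = (c.1.2 * x + c.2) - (w * x + b) by ring.
set A := c.1.2 * x + c.2; set B := w * x + b.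
by rewrite (cosD A B) (cosB A B); field.
Qed.

(* [bernstein m g 0 v] is the mean of [g] under the binomial law [B(m, v)]. *)
Fixpoint bernstein (m : nat) (g : nat -> R) (k : nat) (v : R) : R :=
  if m is m'.+1 then v * bernstein m' g k.+1 v + (1 - v) * bernstein m' g k v
  else g k.

(** For [v = (1 + c) / 2] one has [v p + (1 - v) q = (p + q + c (p - q)) / 2], so closure under
    multiplication by a cosine suffices. *)
Lemma trig_poly_bernstein (m : nat) (g : nat -> R) (k : nat) (w b : R) :
  trig_poly (fun x => bernstein m g k ((1 + cos (w * x + b)) / 2)).
Proof.
elim: m k => [|m IH] k; first exact: trig_poly_cst.
have := trig_polyZ 2^-1 (trig_polyD (trig_polyD (IH k.+1) (IH k))
  (trig_poly_mulcos w b (trig_polyD (IH k.+1) (trig_polyZ (-1) (IH k))))).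
move=> [s sp]; exists s => x; rewrite -sp /=.
by field.
Qed.

Lemma ler_bernstein m (g h : nat -> R) k (v : R) : 0 <= v <= 1 ->
  (forall j, g j <= h j) -> bernstein m g k v <= bernstein m h k v.
Proof.
move=> /andP[v0 v1] gh; elim: m k => [|m IH] k //=.
by rewrite lerD// ler_wpM2l// subr_ge0.
Qed.

Lemma bernstein_cst m (a : R) k v : bernstein m (fun _ => a) k v = a.
Proof. by elim: m k => [|m IH] k //=; rewrite !IH; ring. Qed.

Lemma bernsteinD m (g h : nat -> R) k v :
  bernstein m (fun j => g j + h j) k v = bernstein m g k v + bernstein m h k v.
Proof. by elim: m k => [|m IH] k //=; rewrite !IH; ring. Qed.

Lemma bernsteinZ m (a : R) (g : nat -> R) k v :
  bernstein m (fun j => a * g j) k v = a * bernstein m g k v.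
Proof. by elim: m k => [|m IH] k //=; rewrite !IH; ring. Qed.

Lemma bernstein_variance m (c : R) k v :
  bernstein m (fun j => (j%:R - c) ^+ 2) k v =
  (k%:R + m%:R * v - c) ^+ 2 + m%:R * v * (1 - v).
Proof.
elim: m k => [|m IH] k /=; first by rewrite !mul0r !addr0.
by rewrite !IH -!natr1; ring.
Qed.

Lemma ler_norm_bernstein m (g h : nat -> R) k (v a : R) : 0 <= v <= 1 ->
  (forall j, `|a - g j| <= h j) -> `|a - bernstein m g k v| <= bernstein m h k v.
Proof.
move=> v01 gh; rewrite ler_distlC; apply/andP; split.
  rewrite lerBlDr -bernsteinD -[leLHS](bernstein_cst m _ k v).
  by apply: ler_bernstein => // j; have := gh j; rewrite ler_norml; lra.
rewrite -[X in X + _](bernstein_cst m a k v) -bernsteinD.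
by apply: ler_bernstein => // j; have := gh j; rewrite ler_norml; lra.
Qed.

(** Uniform continuity by compactness of [[a, b]]. Continuity of [h] is available on the image of
    [g] only, while [y] ranges over the whole line. *)
Lemma heine_comp (g h : R -> R) (a b e : R) : 0 < e -> continuous g ->
  (forall x, a <= x <= b -> {for g x, continuous h}) ->
  exists2 d, 0 < d & forall x y, a <= x <= b -> `|g x - y| < d ->
    `|h (g x) - h y| <= e.
Proof.
move=> e0 cg ch.
pose P (d x : R) := forall y, `|g x - y| < d -> `|h (g x) - h y| <= e.
have : \forall d \near 0^'+, `[a, b] `<=` P d.
  have := @segment_compact R a b; rewrite compact_near_coveringP; apply => x.
  rewrite /= in_itv/= => xab.
  have e2 : 0 < e / 2 by rewrite divr_gt0.
  have /cvgrPdist_le /(_ _ e2) /nbhs_ballP[r /= r0 hr] := ch x xab.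
  have r2 : 0 < r / 2 by rewrite divr_gt0.
  have /cvgrPdist_lt /(_ _ r2) gr := cg x.
  near=> x' d => y; have x'r : `|g x - g x'| < r / 2 by near: x'.
  have dr : d < r / 2 by near: d; exact: nbhs_right_lt.
  move=> y'd.
  have h1 : `|h (g x) - h (g x')| <= e / 2.
    by apply: hr; rewrite /ball/= (lt_trans x'r)// ltr_pdivrMr// ltr_pMr// ltr1n.
  have h2 : `|h (g x) - h y| <= e / 2.
    apply: hr; rewrite /ball/= -(subrKA (g x')) (le_lt_trans (ler_normD _ _))//.
    by rewrite (splitr r) ltrD// (lt_trans y'd).
  rewrite (splitr e) -(subrKA (h (g x))) (le_trans (ler_normD _ _))// lerD//.
  by rewrite distrC.
move=> H; near (0 : R)^'+ => d; exists d; first by near: d; exact: nbhs_right_gt.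
move=> x y xab; have Hd : `[a, b] `<=` P d by near: d.
by apply: Hd; rewrite /= in_itv.
Unshelve. all: by end_near. Qed.

(** On [[-K, K]] the function is written as [h (sin (w x))], and [h] is approximated by Bernstein
    polynomials in [(1 + sin (w x)) / 2], which are trigonometric in [x]. Outside, the term
    [e * x ^+ 2] absorbs the bound [2 * M]. *)
Lemma trig_approx (f : R -> R) (M e : R) : continuous f ->
  (forall x, `|f x| <= M) -> 0 < e ->
  exists2 p, trig_poly p & forall x, `|f x - p x| <= e + e * x ^+ 2.
Proof.
move=> cf fM e0.
have M0 : 0 <= M by exact: le_trans (fM 0).
pose K := 1 + 2 * M / e.
have K1 : 1 <= K by rewrite lerDl divr_ge0 ?mulr_ge0// ltW.
have K0 : 0 < K by lra.
have eK : 2 * M <= e * K ^+ 2.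
  have -> : 2 * M = e * (K - 1) by rewrite /K; field; lra.
  by rewrite ler_wpM2l ?(ltW e0)//; nra.
(* Then [|w x| <= pi / 4] on [[-K, K]], so the sine is inverted by [asin] and stays strictly between
   -1 and 1. *)
pose w := pi / (4 * K).
have w0 : 0 < w by rewrite divr_gt0 ?pi_gt0// mulr_gt0.
have wx x : - K <= x <= K -> - (pi / 2) < w * x < pi / 2.
  move=> xK; have := pi_gt0 R => p0.
  have -> : w * x = (pi / 2) * (x / (2 * K)) by rewrite /w; field; lra.
  have p2 : 0 < pi / 2 :> R by lra.
  rewrite -mulrN1 ltr_pM2l// -[X in _ && (_ < X)]mulr1 ltr_pM2l//.
  by rewrite ltr_pdivrMr ?ltr_pdivlMr ?mulr_gt0//; lra.
pose h (y : R) := f (asin y / w).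
pose g (x : R) := sin (w * x).
have cg : continuous g.
  move=> x; apply: (@continuous_comp R R R (fun x => w * x) (@sin R)).
    by apply: cvgM => //; exact: cvg_cst.
  exact: continuous_sin.
have gx x : - K <= x <= K -> -1 < g x < 1.
  move=> xK; rewrite -ltr_norml lt_neqAle sin_max andbT norm_sin_eq1.
  by rewrite gt_eqF// cos_gt0_pihalf// wx.
have hg x : - K <= x <= K -> h (g x) = f x.
  move=> xK; rewrite /h sinK; first by congr f; field; lra.
  by rewrite in_itv/=; have := wx x xK; lra.
have ch x : - K <= x <= K -> {for g x, continuous h}.
  move=> xK; apply: (@continuous_comp R R R (fun y => asin y / w) f); last exact: cf.
  apply: cvgM; last exact: cvg_cst.
  by apply: continuous_asin; exact: gx.
have e2 : 0 < e / 2 by rewrite divr_gt0.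
have [d d0 hd] := heine_comp e2 cg ch.
(* The variance term will be at most [2M / (m d^2)], since [v (1 - v) <= 1/4]; this [m] makes it at
   most [e / 2]. *)
have [m m0 mM] : exists2 m : nat, (0 < m)%N & 4 * M / (e * d ^+ 2) <= m%:R.
  exists (Num.truncn (4 * M / (e * d ^+ 2))).+1 => //.
  by rewrite ltW// truncnS_gt.
pose G (j : nat) := h (2 * j%:R / m%:R - 1).
exists (fun x => bernstein m G 0 ((1 + cos (w * x + - (pi / 2))) / 2)).
  exact: trig_poly_bernstein.
move=> x; rewrite cosBpihalf -/(g x).
set v := (1 + g x) / 2.
have v01 : 0 <= v <= 1.
  by have := sin_max (w * x); rewrite ler_norml -/(g x) /v; lra.
have m0' : 0 < m%:R :> R by rewrite ltr0n.
have [/andP[xK1 xK2]|xK] := boolP (- K <= x <= K).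
  have xK : - K <= x <= K by rewrite xK1.
  (* Chebyshev's argument: nodes within [d] of [g x] are handled by uniform continuity; at the
     others [2M] is at most [2M] times the squared ratio of the distance to [d]. *)
  have Gj j : `|f x - G j| <= e / 2 + 8 * M / (m%:R ^+ 2 * d ^+ 2) * (j%:R - m%:R * v) ^+ 2.
    have q0 : 0 <= 8 * M / (m%:R ^+ 2 * d ^+ 2) * (j%:R - m%:R * v) ^+ 2.
      apply: mulr_ge0; last exact: sqr_ge0.
      by apply: divr_ge0; apply: mulr_ge0 => //; exact: sqr_ge0.
    rewrite /G; set y := 2 * j%:R / m%:R - 1.
    have [yd|yd] := ltP `|g x - y| d.
      by rewrite -(hg x xK) (le_trans (hd x y xK yd))// lerDl.
    rewrite (@le_trans _ _ (2 * M))//.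
      by rewrite (le_trans (ler_normB _ _))// mulrDl mul1r lerD// fM.
    rewrite (@le_trans _ _
      (8 * M / (m%:R ^+ 2 * d ^+ 2) * (j%:R - m%:R * v) ^+ 2))//; last first.
      by rewrite lerDr ltW.
    have -> : 8 * M / (m%:R ^+ 2 * d ^+ 2) * (j%:R - m%:R * v) ^+ 2 =
        2 * M * ((g x - y) ^+ 2 / d ^+ 2).
      by rewrite /y /v; field; rewrite !gt_eqF.
    rewrite ler_peMr ?mulr_ge0// ler_pdivlMr ?exprn_gt0// mul1r.
    by rewrite -[leRHS]real_normK ?num_real// lerXn2r ?nnegrE// ltW.
  rewrite (le_trans (ler_norm_bernstein _ _ v01 Gj))//.
  rewrite bernsteinD bernstein_cst bernsteinZ bernstein_variance.
  rewrite add0r subrr expr0n/= add0r.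
  rewrite (@le_trans _ _ e)//; last by rewrite lerDl mulr_ge0 ?sqr_ge0// ltW.
  rewrite [leRHS](splitr e) lerD2l.
  have -> : 8 * M / (m%:R ^+ 2 * d ^+ 2) * (m%:R * v * (1 - v)) =
      8 * M * (v * (1 - v)) / (m%:R * d ^+ 2) by field; rewrite !gt_eqF.
  rewrite ler_pdivrMr ?mulr_gt0 ?exprn_gt0//.
  move: mM; rewrite ler_pdivrMr ?mulr_gt0 ?exprn_gt0// => mM.
  have -> : e / 2 * (m%:R * d ^+ 2) = m%:R * (e * d ^+ 2) / 2 by field.
  have vv : v * (1 - v) <= 4^-1 by have := sqr_ge0 (v - 2^-1); rewrite expr2; lra.
  have : 8 * M * (v * (1 - v)) <= 8 * M * 4^-1 by rewrite ler_wpM2l// mulr_ge0.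
  lra.
have Gj j : `|f x - G j| <= 2 * M.
  by rewrite (le_trans (ler_normB _ _))// mulrDl mul1r lerD// fM.
rewrite (le_trans (ler_norm_bernstein _ _ v01 Gj))// bernstein_cst.
rewrite (le_trans eK)// (@le_trans _ _ (e * x ^+ 2))//; last by rewrite lerDr ltW.
rewrite ler_wpM2l ?(ltW e0)//.
have : K < `|x| by rewrite ltNge ler_norml.
move=> Kx; rewrite -[leRHS]real_normK ?num_real//.
by rewrite lerXn2r ?nnegrE ?(ltW K0)// ltW.
Qed.

End trigonometric_approximation.

(** * Weak convergence *)

Section weak_limit.
Variable R : realType.
Local Notation mu := (@lebesgue_measure R).
Local Notation phi := (normal_pdf (0 : R) 1).

Lemma integral_normal_trig (s : seq (R * R * R)) :
  mu.-integrable [set: R]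
    (fun x => ((\sum_(c <- s) c.1.1 * cos (c.1.2 * x + c.2)) * phi x)%:E) /\
  \int[mu]_x ((\sum_(c <- s) c.1.1 * cos (c.1.2 * x + c.2)) * phi x) =
  \sum_(c <- s) c.1.1 * (expR (- c.1.2 ^+ 2 / 2) * cos c.2).
Proof.
elim: s => [|c s [IH1 IH2]].
  split.
    by under eq_fun do rewrite big_nil mul0r; exact: integrable0.
  under eq_Rintegral do rewrite big_nil mul0r.
  by rewrite big_nil Rintegral_cst// mul0r.
have ic := integrable_cos_normal_pdf c.1.2 c.2 c.1.1.
split.
  under eq_fun do rewrite big_cons mulrDl EFinD.
  exact: integrableD.
under eq_Rintegral do rewrite big_cons mulrDl.
rewrite RintegralD// IH2 big_cons; congr (_ + _).
under eq_Rintegral do rewrite -mulrA.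
rewrite RintegralZl// ?integral_normal_cos//.
have := integrable_cos_normal_pdf c.1.2 c.2 1.
by under eq_fun do rewrite mul1r.
Qed.

Lemma walk_trig_cvg (X : nat -> bool) (m : nat) (p : R -> R) :
  (fluctuation R (mkseq X n.+1) @[n --> \oo] --> (0 : R)) -> trig_poly p ->
  walk (mkseq X n.+1 ++ nseq m false) (fun _ d _ => p (rescale R n d)) false 0 0
    @[n --> \oo] --> \int[mu]_x (p x * phi x).
Proof.
move=> X0 [s sp].
have -> : \int[mu]_x (p x * phi x) =
    \sum_(c <- s) c.1.1 * (expR (- c.1.2 ^+ 2 / 2) * cos c.2).
  by rewrite -(integral_normal_trig s).2; apply: eq_Rintegral => x _; rewrite sp.
have E n : walk (mkseq X n.+1 ++ nseq m false) (fun _ d _ => p (rescale R n d)) false 0 0 =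
  \sum_(c <- s) c.1.1 * walk (mkseq X n.+1 ++ nseq m false)
    (fun _ d _ => cos (angle c.1.2 n * d%:~R + c.2)) false 0 0.
  under [RHS]eq_bigr do rewrite -walkZ.
  rewrite -walk_sum; apply: eq_walk => _ d _; rewrite sp.
  by apply: eq_bigr => c _; rewrite /rescale /angle mulrA.
under eq_fun do rewrite E.
apply: cvg_sum_seq => c; apply: cvgM; first exact: cvg_cst.
by apply: (@walk_cos_cvg_nseq _ (fun n => mkseq X n.+1)) => // n; rewrite size_mkseq.
Qed.

(** The second moment is at most the number [n + 1 + m <= 3n] of digits, so rescaling by [2 / n]
    gives at most 6. This uniform bound plays the role of tightness. *)
Lemma walk_sqr_rescale_le (X : nat -> bool) (m n : nat) : (0 < n)%N -> (m <= n)%N ->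
  walk (mkseq X n.+1 ++ nseq m false) (fun _ d _ => 1 + rescale R n d ^+ 2) false 0 0
    <= 7 :> R.
Proof.
move=> n0 mn; have n0' : 0 < n%:R :> R by rewrite ltr0n.
rewrite walkD walk_cst.
have -> : walk (mkseq X n.+1 ++ nseq m false) (fun _ d _ => rescale R n d ^+ 2) false 0 0
  = 2 / n%:R * walk (mkseq X n.+1 ++ nseq m false) (fun _ d _ => d%:~R ^+ 2) false 0 0 :> R.
  rewrite -walkZ; apply: eq_walk => _ d _.
  by rewrite /rescale exprMn sqr_sqrtr// divr_ge0.
have := walk_sqr_le R (mkseq X n.+1 ++ nseq m false).
rewrite size_cat size_mkseq size_nseq => h.
have h3 : (n.+1 + m)%:R <= 3 * n%:R :> R by rewrite -natrM ler_nat; lia.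
have : 2 / n%:R * walk (mkseq X n.+1 ++ nseq m false) (fun _ d _ => d%:~R ^+ 2) false 0 0
   <= 2 / n%:R * (3 * n%:R) :> R.
  by rewrite ler_wpM2l ?divr_ge0// (le_trans h).
have -> : 2 / n%:R * (3 * n%:R) = 6 :> R by field; lra.
lra.
Qed.

(** Four comparisons: the integral of [f] with its walk, the walk of [f] with that of a
    trigonometric [p], the walk of [p] with the normal integral of [p], and the latter with that of
    [f]. *)
Lemma weak_cvg_normal (X : nat -> bool) :
  (fluctuation R (mkseq X n.+1) @[n --> \oo] --> (0 : R)) ->
  weak_cvg (fun n : nat => @mu_tilde R X n) (normal_prob (0 : R) 1).
Proof.
move=> X0 f cf [M fM].
have M0 : 0 <= M by exact: le_trans (fM 0).
have mf : measurable_fun [set: R] f by exact: continuous_measurable_fun.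
rewrite (integral_normal_prob mf fM).
under eq_fun do rewrite (integral_mu_tilde X _ cf fM).
have If : mu.-integrable [set: R] (fun x => (f x * phi x)%:E).
  apply: (integrable_normal_pdf_mul (K := M)) => // x.
  by rewrite (le_trans (fM x))// ler_peMr// lerDl sqr_ge0.
have -> : (\int[mu]_x (f x * phi x)%:E = (\int[mu]_x (f x * phi x))%:E)%E.
  by rewrite fineK//; exact: integrable_fin_num.
apply: cvg_EFin; first exact: nearW.
apply/cvgrPdist_le => /= e e0.
pose C := \int[mu]_x ((1 + x ^+ 2) * phi x).
have I1 : mu.-integrable [set: R] (fun x => ((1 + x ^+ 2) * phi x)%:E).
  apply: (integrable_normal_pdf_mul (K := 1)).
    by apply: measurable_funD => //; exact: measurable_funX.
  by move=> x; rewrite mul1r ger0_norm// addr_ge0 ?sqr_ge0.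
have C0 : 0 <= C.
  apply: Rintegral_ge0 => x _.
  by rewrite mulr_ge0 ?normal_pdf_ge0// addr_ge0 ?sqr_ge0.
(* The two replacements of [f] by [p] cost [7h] and [C h], together [e / 4]. Both [p] and the
   padding length [m] are fixed before [n] grows. *)
pose h := e / (4 * (7 + C)).
have h0 : 0 < h by rewrite divr_gt0// mulr_gt0//; lra.
have [p tp fp] := trig_approx cf fM h0.
have [m mM] : exists m : nat, 2 * M * 2^-1 ^+ m <= e / 4.
  have : 2 * M * 2^-1 ^+ m @[m --> \oo] --> (0 : R).
    rewrite -[X in _ --> X](mulr0 (2 * M)); apply: cvgM; first exact: cvg_cst.
    by apply: cvg_expr; rewrite ger0_norm ?invr_ge0// invf_lt1 ?ltr1n.
  have e4 : 0 < e / 4 by rewrite divr_gt0.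
  move=> /cvgr0Pnorm_le /(_ _ e4) [m _ /(_ m (leqnn _)) me].
  by exists m; rewrite (le_trans (ler_norm _)).
have Ip : mu.-integrable [set: R] (fun x => (p x * phi x)%:E).
  have [s sp] := tp; have [+ _] := integral_normal_trig s.
  by under eq_fun do rewrite -sp.
have Jfp : `|\int[mu]_x (f x * phi x) - \int[mu]_x (p x * phi x)| <= h * C.
  rewrite -RintegralB//.
  rewrite (@le_trans _ _ (\int[mu]_x `|f x * phi x - p x * phi x|))//.
    apply: le_normr_Rintegral => //.
    exact: (integrableB measurableT If Ip).
  rewrite /C -RintegralZl//; apply: le_Rintegral => //.
  - apply: (@eq_integrable _ _ _ mu _ measurableT
      (abse \o (fun x => ((f x * phi x)%:E - (p x * phi x)%:E)%E))) => //.
    by apply: integrable_abse; exact: integrableB.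
  - exact: (integrableZl measurableT h I1).
  move=> x _; rewrite -mulrBl normrM [X in _ * X]ger0_norm ?normal_pdf_ge0//.
  by rewrite mulrA ler_wpM2r ?normal_pdf_ge0// mulrDr mulr1.
have e4 : 0 < e / 4 by rewrite divr_gt0.
have /cvgrPdist_le /(_ _ e4) Wp := walk_trig_cvg m X0 tp.
near=> n.
have n0 : (0 < n)%N by near: n; exact: nbhs_infty_gt.
have mn : (m <= n)%N by near: n; exact: nbhs_infty_ge.
have Wpn : `|\int[mu]_x (p x * phi x) - walk (mkseq X n.+1 ++ nseq m false)
    (fun _ d _ => p (rescale R n d)) false 0 0| <= e / 4 by near: n.
have Wfp : `|walk (mkseq X n.+1 ++ nseq m false)
      (fun _ d _ => f (rescale R n d)) false 0 0 -
    walk (mkseq X n.+1 ++ nseq m false)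
      (fun _ d _ => p (rescale R n d)) false 0 0| <= h * 7.
  rewrite -walkB (le_trans (ler_norm_walk _ _ _ _ _))//.
  rewrite (@le_trans _ _ (walk (mkseq X n.+1 ++ nseq m false)
    (fun _ d _ => h * (1 + rescale R n d ^+ 2)) false 0 0))//.
    by apply: ler_walk => _ d _; rewrite (le_trans (fp _))// mulrDr mulr1.
  by rewrite walkZ ler_wpM2l ?walk_sqr_rescale_le// ltW.
have If' : `|\int[mu_ R (aX X n)]_(k in [set: int]) f (rescale R n k) -
    walk (mkseq X n.+1 ++ nseq m false)
      (fun _ d _ => f (rescale R n d)) false 0 0| <= e / 4.
  rewrite (le_trans _ mM)// -(val2_digits X n m).
  by apply: (@mu_integral_approx _ _ _ (fun d => f (rescale R n d))) => d; exact: fM.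
have hE : h * 7 + h * C = e / 4 by rewrite /h; field; lra.
move: Jfp Wpn Wfp If' hE; rewrite !ler_norml.
move: (\int[_]_x _) (\int[_]_x _) (\int[_]_x _) (walk _ _ _ _ _) (walk _ _ _ _ _).
move=> a b c a' b'; move: (h * C) (h * 7) => u v; lra.
Unshelve. all: by end_near. Qed.

End weak_limit.

Theorem theorem1p10 (R : realType) (P : probability bitseq_space R)
    (hP : balanced_bernoulli P) :
  {ae P, forall X : bitseq_space,
    weak_cvg (fun n : nat => @mu_tilde R X n) (normal_prob (0 : R) 1)}.
Proof.
by apply: filterS (fluctuation_cvg0 hP) => X; exact: weak_cvg_normal.
Qed.
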